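(* Let $X$ be a finite group with $\alpha(X)>3/4$. Then $X$ is a direct product of an elementary abelian $2$-group with a group $G$ such that $\alpha(X)=\alpha(G)$, $G$ does not have $C_2$ as a direct factor, and either $G$ is trivial (in which case $\alpha(X)=1$) or one of the following occurs. (1) Case I. $G\cong A\rtimes\langle\varepsilon\rangle$, where $\langle\varepsilon\rangle\cong C_2$ acts on $A$ by inversion, and there exists an integer $n\ge 1$ such that one of the following occurs: $$A={C_3}^n,\ \ \alpha(G)=\frac{3\cdot 3^n+1}{4\cdot 3^n}\qquad\text{or}\qquad A={C_4}^n,\ \ \alpha(G)=\frac{3\cdot 2^n+1}{4\cdot 2^n}.$$ (2) Case II. $G\cong D_8\times D_8$ and $\alpha(G)=25/32$. (3) Case III. For some integer $r\ge 1$, $G$ is isomorphic to the quotient ${D_8}^r/N$ where $N=\{(a_1,\ldots,a_r)\in Z(D_8)^r : a_1\cdots a_r=1\}$, and $$\alpha(G)=\frac{3\cdot 2^r+1}{4\cdot 2^r}.$$ (4) Case IV. For some integer $r\ge 1$, $G$ is isomorphic to a semidirect product $V\rtimes\langle c\rangle$ where $V={\mathbb{F}_2}^{2r}$ (written multiplicatively) has a basis $\{x_1,y_1,\ldots,x_r,y_r\}$, $c$ has order $2$, $c$ acts trivially on each $y_i$, $x_i^c=cx_ic=[c,x_i]x_i=x_iy_i$ for $i=1,\ldots,r$, and $$\alpha(G)=\frac{3\cdot 2^r+1}{4\cdot 2^r}.$$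
   Context: For a finite group $H$, $c(H)$ denotes the number of cyclic subgroups of $H$ (including the trivial one) and $\alpha(H):=c(H)/|H|$. $C_m$ denotes the cyclic group of order $m$, $D_8$ the dihedral group of order $8$, $Z(H)$ the center of $H$, and $H^r$ the direct product of $r$ copies of $H$. The trivial group is regarded as an elementary abelian $2$-group. (In Case IV, $c$ denotes a group element, not the function $c(\cdot)$.) *)

(* Defs.v *)
From HB Require Import structures.
From mathcomp Require Import all_boot all_order all_fingroup all_algebra.
From mathcomp Require Import all_solvable.

Set Implicit Arguments.
Unset Strict Implicit.
Unset Printing Implicit Defensive.

Import GroupScope GRing.Theory.

Definition ncyclic (gT : finGroupType) (H : {set gT}) : nat :=
  #|[set C in subgroups H | cyclic C]|.

Definition alpha (gT : finGroupType) (H : {set gT}) : rat :=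
  ((ncyclic H)%:R / #|H|%:R)%R.

Definition has_C2_factor (gT : finGroupType) (G : {set gT}) : Prop :=
  exists C K : {group gT}, C \isog [set: 'Z_2] /\ C \x K = G.

Notation gpow gT n := {dffun forall i : 'I_n, (fun _ : 'I_n => gT : finGroupType) i}.

Definition alpha_val (q : nat) : rat := ((3 * q%:R + 1) / (4 * q%:R))%R.

Definition caseI (gT : finGroupType) (G : {group gT}) : Prop :=
  exists (A : {group gT}) (e : gT),
    [/\ A ><| <[e]> = G, #[e] = 2, {in A, forall a, a ^ e = a^-1} &
        exists n : nat, (0 < n)%N /\
          ((A \isog [set: gpow 'Z_3 n] /\ alpha G = alpha_val (3 ^ n)%N) \/
           (A \isog [set: gpow 'Z_4 n] /\ alpha G = alpha_val (2 ^ n)%N))].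

Definition caseII (gT : finGroupType) (G : {group gT}) : Prop :=
  G \isog setX 'D_8 'D_8 /\ alpha G = (25%:R / 32%:R)%R.

Notation D8pow r := (gpow ('D_8)%type r).

(* The product is a group product; its factors are central, so its order is
   immaterial. *)
Definition D8ker (r : nat) : {set D8pow r} :=
  [set a : D8pow r | [forall i, a i \in 'Z('D_8)] && (\prod_(i < r) a i == 1)].

Lemma D8ker_group_set r : group_set (D8ker r).
Proof.
apply/group_setP; split.
  rewrite inE; apply/andP; split; first by apply/forallP=> i; rewrite ffunE group1.
  by rewrite big1 // => i _; rewrite ffunE.
move=> a b; rewrite !inE => /andP[/forallP aZ /eqP a1] /andP[/forallP bZ /eqP b1].
apply/andP; split.
  by apply/forallP=> i; rewrite ffunE groupM.
suff -> : \prod_(i < r) (a * b) i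
          = (\prod_(i < r) a i) * (\prod_(i < r) b i) by rewrite a1 b1 mulg1.
elim/big_rec3: _ => [|i u v w _ ->]; first by rewrite mulg1.
rewrite ffunE -!mulgA; congr (_ * _); rewrite !mulgA; congr (_ * _).
by have /centerP[_ cb] := bZ i; apply: cb; rewrite inE.
Qed.

Canonical D8ker_group r := Group (D8ker_group_set r).

Definition caseIII (gT : finGroupType) (G : {group gT}) : Prop :=
  exists r : nat, [/\ (0 < r)%N, G \isog [set: D8pow r] / D8ker r &
                      alpha G = alpha_val (2 ^ r)%N].

(* V is the image of the additive group of F_2^(2r) under the isomorphism f,
   which rewrites it multiplicatively; the basis is {u_i} U {v_i}, with
   x_i = f u_i and y_i = f v_i.  Since c and x_i are involutions,
   x_i ^ c = c^-1 * x_i * c coincides with c * x_i * c and with [c, x_i] * x_i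
   (under either convention for commutators). *)
Definition caseIV (gT : finGroupType) (G : {group gT}) : Prop :=
  exists (r : nat) (V : {group gT}) (c : gT)
         (f : {morphism [set: 'rV['F_2]_(2 * r)] >-> gT})
         (u v : 'I_r -> 'rV['F_2]_(2 * r)),
    [/\ (0 < r)%N /\ alpha G = alpha_val (2 ^ r)%N,
        isom [set: 'rV['F_2]_(2 * r)] V f /\
          basis_of fullv (codom u ++ codom v),
        V ><| <[c]> = G /\ #[c] = 2 &
        forall i : 'I_r,
          f (v i) ^ c = f (v i) /\ f (u i) ^ c = f (u i) * f (v i)].

(* Main.v *)
Require Import Defs.
From mathcomp Require Import all_boot all_order all_fingroup all_algebra.
From mathcomp Require Import all_solvable zify ring lra.

Import GroupScope.

(** A cyclic group of order [m] has [totient m] generators, so weighting every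
    element [x] of a group by the inverse of [totient #[x]] counts each cyclic
    subgroup once ([ncyclic_weight]).  Elements with [x ^+ 2 = 1], loosely called
    involutions below although 1 is among them, have weight 1, and all the
    others have weight at most one half.  Hence [alpha X > 3/4] forces more than
    half of the elements of [X] to be involutions ([alpha_gt_involutions]).
    Moreover a direct factor of order 2 does not change [alpha] ([alpha_dprod]),
    so that all of them can be split off at the beginning ([split_C2_factors]).

    The groups in which more than half of the elements are involutions were
    classified by Wall ([mostly_involutions]).  Let [H] be a maximal elementary
    abelian 2-subgroup.  For an involution [g], the involutions of the coset
    [H :* g] form a coset of ['C_H[g]], so a coset other than [H] consists of
    involutions for at most one half.  Counting then shows that every coset
    contains involutions ([rcoset_meets_Ldiv2]) and that the index of ['C_H[g]]
    in [H] exceeds 2 for at most one coset ([rcoset_index_gt2_uniq]).  Whenever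
    the index is at most 2, commuting with [g] is a linear condition on [H], seen
    as a vector space over the field of two elements.  This leaves three
    situations: there is an exceptional coset of index at least 4
    ([exceptional_coset]), all the hyperplanes ['C_H[g]] coincide
    ([common_hyperplane]), or [G] acts on [H] by transvections with different
    axes and therefore a common centre ([transvections_sqr_central]).  Together
    they produce four types of groups: an abelian group extended by inversion, an
    elementary abelian group extended by an involution, a central product of the
    centre with two dihedral groups of order 8, and a group all of whose squares
    are 1 or a fixed central involution.

    Each type is then brought to its normal form with the help of one remark: in
    a 2-group without direct factor of order 2 every central involution lies in
    the Frattini subgroup, hence in any normal subgroup containing all the
    squares ([central_involution_sqr]).
    - In an abelian group extended by inversion, elements whose order divides
      neither 4 nor 6 have weight at most one quarter; there are too many of them
      unless the exponent divides 4 or 6 ([abelian_sum_weight_exponent]), and the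
      remark leaves powers of cycles of order 4 or 3.
    - In an elementary abelian group [V] extended by an involution [c], the remark
      gives that the fixed points ['C_V[c]] are the commutators [[~ v, c]]; lifting
      a basis of the latter gives the matrix of [c] ([abelem_index2_caseIV]).
    - In the third type the centre is generated by the two commutators, and the
      product of the dihedral groups is direct ([commuting_pairs_caseII]).
    - In the fourth type the centre has order 2 and squaring is a quadratic form
      modulo it, with a large totally singular subspace; splitting it into
      hyperbolic planes ([hyperbolic_pairs]) exhibits the group as a central
      product of dihedral groups ([D8pow_quotient_isog]).
    In all of them only the orders 1, 2, 3, 4 and 6 occur, so [alpha] follows from
    the number of involutions ([alpha_eq_val]). *)

Set Implicit Arguments.
Unset Strict Implicit.
Unset Printing Implicit Defensive.

(** * Cosets of a maximal elementary abelian subgroup *)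


Section Involutions.

Variable gT : finGroupType.
Implicit Types (x y h u : gT) (G H K : {group gT}).

Lemma invg2 x : x ^+ 2 = 1 -> x^-1 = x.
Proof. by move=> x2; apply/eqP; rewrite eq_invg_mul -expg2 x2. Qed.

Lemma commute2 x y :
  x ^+ 2 = 1 -> y ^+ 2 = 1 -> (x * y) ^+ 2 = 1 <-> commute x y.
Proof.
move=> x2 y2; split=> [xy2 | cxy]; last by rewrite expgMn // x2 y2 mulg1.
by rewrite /commute -{2}(invg2 x2) -{2}(invg2 y2) -invMg invg2.
Qed.

Lemma mul2_inverts h u : h ^+ 2 = 1 -> (h * u) ^+ 2 = 1 <-> u ^ h = u^-1.
Proof.
move=> h2; rewrite /conjg (invg2 h2) expg2 !mulgA.
split=> [/(canRL (mulgK _)) -> | ->]; [exact: mul1g | exact: mulVg].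
Qed.

Lemma commg_sqrs x y : [~ x, y] = (x ^+ 2)^-1 * (x * y^-1) ^+ 2 * y ^+ 2.
Proof. by rewrite !expg2 invMg /commg /conjg !mulgA !mulgKV. Qed.

Lemma index2_mul {H K : {group gT}} x y : K \subset H -> #|H : K| = 2 ->
  x \in H -> y \in H -> x \notin K -> y \notin K -> x * y \in K.
Proof.
move=> sKH iHK xH yH xK yK; have nKH := normal_norm (index2_normal sKH iHK).
have cHK : #|H / K| = 2 by rewrite card_quotient.
have nt z : z \in H -> z \notin K -> coset K z != 1.
  by move=> zH; apply: contra => /eqP; exact/coset_idr/(subsetP nKH).
have [xN yN] := (subsetP nKH x xH, subsetP nKH y yH).
apply: coset_idr; rewrite ?groupM // morphM //.
have : #|[set 1; coset K x]| = 2 by rewrite cards2 eq_sym nt.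
rewrite -cHK => c2.
have /setP/(_ (coset K y)) : [set 1; coset K x] = (H / K)%g.
  apply/eqP; rewrite eqEcard c2 leqnn andbT.
  by apply/subsetP=> _ /set2P[]->; rewrite ?group1 ?mem_quotient.
rewrite (mem_quotient K yH) !inE (negPf (nt y yH yK)) /= => /eqP ->.
by rewrite -expg2 -cHK expg_cardG // mem_quotient.
Qed.

End Involutions.

Section Cosets.

Variables (gT : finGroupType) (G H : {group gT}).
Hypothesis maxH : H \in 'E*_2(G).
Implicit Types (g h x y : gT) (B : {set gT}).

Lemma maxE_sub : H \subset G.
Proof. by have /pmaxElemP[/pElemP[]] := maxH. Qed.

Lemma maxE_abelian : abelian H.
Proof. by have /pmaxElemP[/pElemP[_ /abelem_abelian]] := maxH. Qed.

Lemma maxE_sqr h : h \in H -> h ^+ 2 = 1.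
Proof.
have /pmaxElemP[/pElemP[_ /abelemP-/(_ isT)[_ H2]] _] := maxH; exact: H2.
Qed.

Lemma maxE_cent x : x \in G -> x ^+ 2 = 1 -> x \in 'C(H) -> x \in H.
Proof.
have /(pmaxElem_LdivP (isT : prime 2)) defH := maxH.
by move=> xG x2 cHx; rewrite -defH; apply/LdivP; rewrite inE xG.
Qed.

Lemma cent1H_index g : #|H : 'C_H[g]| <= 1%N -> g \in 'C(H).
Proof.
move=> iH; have : H \subset 'C_H[g] by rewrite -indexg_eq1 eqn_leq iH indexg_gt0.
by rewrite subsetI subxx sub_cent1.
Qed.

Lemma rcoset_cent1 g h : h \in H -> 'C_H[h * g] = 'C_H[g].
Proof.
move=> hH; apply/setP=> k; rewrite !in_setI; case kH: (k \in H) => //=.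
have ckh : commute k h by apply: (centsP maxE_abelian).
apply/cent1P/cent1P=> c; last exact: commuteM.
by rewrite -(mulKg h g); apply: commuteM; first exact: commuteV.
Qed.

Lemma lcoset_cent1 g h : h \in H -> 'C_H[g * h] = 'C_H[g].
Proof.
move=> hH; apply/setP=> k; rewrite !in_setI; case kH: (k \in H) => //=.
have ckh : commute k h by apply: (centsP maxE_abelian).
apply/cent1P/cent1P=> c; last exact: commuteM.
by rewrite -(mulgK h g); apply: commuteM; last exact: commuteV.
Qed.

(** For involutions [g] and [h], the product [h * g] is again an involution
    exactly when [g] and [h] commute. *)
Lemma Ldiv2_rcoset g : g ^+ 2 = 1 -> 'Ldiv_2(H :* g) = 'C_H[g] :* g.
Proof.
move=> g2; apply/setP=> x; rewrite !(mem_rcoset, in_setI) [x \in Ldiv _ _]inE.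
case hH: (_ \in H) => //=; have h2 := maxE_sqr hH.
by rewrite -{1}(mulgKV g x); apply/eqP/cent1P=> ?; apply/commute2.
Qed.

Lemma card_Ldiv2_rcosets :
  #|'Ldiv_2(G)| = \sum_(B in rcosets H G) #|'Ldiv_2(B)|.
Proof.
rewrite -sum1_card (partition_big (rcoset H) [in rcosets H G]) => [|x]; last first.
  by case/LdivP=> xG _; apply/rcosetsP; exists x; rewrite ?rcosetE.
apply: eq_bigr => _ /rcosetsP[x xG ->]; rewrite -sum1_card.
apply: eq_bigl => y; rewrite !inE rcosetE andbAC (sameP eqP rcoset_eqP).
congr (_ && _); apply: andb_idl => /rcosetP[h hH ->].
by rewrite groupM // (subsetP maxE_sub).
Qed.

Lemma card_Ldiv2_maxE : #|'Ldiv_2(H)| = #|H|.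
Proof.
congr #|pred_of_set _|; apply/setIidPl/subsetP=> h /maxE_sqr h2.
by rewrite inE h2.
Qed.

(** The involutions of a coset which contains one form a coset of some
    ['C_H[g]]; a lower bound on the index of these centralisers bounds their
    number. *)
Lemma card_Ldiv2_rcoset_le k B : B \in rcosets H G ->
    (forall g, B = H :* g -> g \in G -> g ^+ 2 = 1 -> k <= #|H : 'C_H[g]|) ->
  k * #|'Ldiv_2(B)| <= #|H|.
Proof.
move=> HB kle; have [-> | [g /LdivP[gB g2]]] := set_0Vmem 'Ldiv_2(B).
  by rewrite cards0 muln0.
case/rcosetsP: HB gB kle => x xG -> gx kle.
have eqB : H :* x = H :* g by apply/esym/rcoset_eqP.
have gG : g \in G.
  by case/rcosetP: gx => h hH ->; rewrite groupM // (subsetP maxE_sub).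
rewrite eqB Ldiv2_rcoset // card_rcoset -(Lagrange (subsetIl H 'C[g])) mulnC.
by rewrite leq_mul2l kle ?orbT.
Qed.

(** An involution which centralises [H] lies in [H] by maximality; in all other
    cosets the index is at least 2. *)
Lemma card_Ldiv2_rcoset_half B : B \in rcosets H G -> B != H ->
  2 * #|'Ldiv_2(B)| <= #|H|.
Proof.
move=> HB ntB; apply: card_Ldiv2_rcoset_le => // g defB gG g2.
rewrite ltnNge; apply: contra ntB => /cent1H_index/(maxE_cent gG g2) gH.
by rewrite defB rcoset_id.
Qed.

Hypothesis wallG : #|G| < 2 * #|'Ldiv_2(G)|.

Lemma sum_rcosets_lt :
  \sum_(B in rcosets H G | B != H) #|H|
    < #|H| + \sum_(B in rcosets H G | B != H) 2 * #|'Ldiv_2(B)|.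
Proof.
have HH : (H : {set gT}) \in rcosets H G by apply/rcosetsP; exists 1; rewrite ?mulg1.
move: wallG; rewrite -(Lagrange maxE_sub) card_Ldiv2_rcosets mulnC.
rewrite -sum_nat_const (bigD1 (H : {set gT}) HH) /=.
rewrite big_distrr /= (bigD1 (H : {set gT}) HH) /=.
by rewrite card_Ldiv2_maxE mul2n -addnn -addnA ltn_add2l.
Qed.

(** More than half of [G] squares to 1 and each nontrivial coset of [H]
    contributes at most half of itself; so no coset can contribute nothing. *)
Lemma rcoset_meets_Ldiv2 g : g \in G -> exists2 h, h \in H & (h * g) ^+ 2 = 1.
Proof.
move=> gG; have [|[x /LdivP[/rcosetP[h hH ->] x2]]] := set_0Vmem 'Ldiv_2(H :* g); last first.
  by exists h.
have HB : H :* g \in rcosets H G by apply/rcosetsP; exists g.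
have [gH | gH] := boolP (g \in H); first by exists g^-1; rewrite ?groupV // mulVg expg1n.
have nB : H :* g != H by apply: contra gH => /eqP <-; apply: rcoset_refl.
have HB' : (H :* g \in rcosets H G) && (H :* g != H) by rewrite HB.
move=> B0; have := sum_rcosets_lt.
rewrite (bigD1 (H :* g) HB') /= [in X in _ < X](bigD1 (H :* g) HB') /=.
rewrite B0 cards0 muln0 add0n ltn_add2l ltnNge => /negP[].
by apply: leq_sum => B /andP[/andP[]] *; apply: card_Ldiv2_rcoset_half.
Qed.

(** All the terms of [sum_rcosets_lt] balance in favour of the left-hand side
    except for the excess [#|H|] on the right; two cosets with at most
    [#|H| / 4] involutions each would use it up.  Indices in the 2-group [H]
    exceeding 2 are at least 4. *)
Lemma rcoset_index_gt2_uniq x y : x \in G -> y \in G ->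
  2 < #|H : 'C_H[x]| -> 2 < #|H : 'C_H[y]| -> y \in H :* x.
Proof.
have ix4 z : z \in G -> 2 < #|H : 'C_H[z]| -> 4 * #|'Ldiv_2(H :* z)| <= #|H|.
  move=> zG i2; have HB : H :* z \in rcosets H G by apply/rcosetsP; exists z.
  apply: card_Ldiv2_rcoset_le => // g /rcoset_eqP/rcosetP[h hH defz] gG g2.
  move: i2; rewrite defz rcoset_cent1 //.
  have /p_natP[n ->] : 2.-nat #|H : 'C_H[g]|.
    apply: pnat_dvd (dvdn_indexg _ _) _.
    by have /pmaxElemP[/pElemP[_ /abelem_pgroup]] := maxH.
  by case: n => [|[|n]] //; rewrite !expnS; have := expn_gt0 2 n; lia.
move=> xG yG ix iy; have ltsum := sum_rcosets_lt.
apply/idPn => xy; move: ltsum; apply/negP; rewrite -leqNgt.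
have nt z : z \in G -> 2 < #|H : 'C_H[z]| ->
    (H :* z \in rcosets H G) && (H :* z != H).
  move=> zG iz; apply/andP; split; first by apply/rcosetsP; exists z.
  apply: contraTneq iz => defH; have zH : z \in H by rewrite -defH rcoset_refl.
  rewrite -(mulg1 z) rcoset_cent1 // (_ : 'C_H[1] = H) ?indexgg //.
  by apply/setIidPl; rewrite cent11T subsetT.
rewrite (bigD1 (H :* x) (nt _ xG ix)) /=.
rewrite [in X in _ <= X](bigD1 (H :* x) (nt _ xG ix)) /=.
have ntyx : ((H :* y \in rcosets H G) && (H :* y != H)) && (H :* y != H :* x).
  by rewrite nt //=; apply: contra xy => /eqP/rcoset_eqP.
rewrite (bigD1 (H :* y) ntyx) /= [in X in _ <= X](bigD1 (H :* y) ntyx) /=.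
set s := (X in _ + (_ + (_ + X)) <= _); set t := (X in _ <= _ + (_ + X)).
have : s <= t.
  by apply: leq_sum => B /andP[/andP[/andP[]]] *; apply: card_Ldiv2_rcoset_half.
move: (ix4 x xG ix) (ix4 y yG iy).
by move: #|'Ldiv_2(H :* x)| #|'Ldiv_2(H :* y)| #|H| s t => a b c s t; lia.
Qed.

(** An element of the centraliser differs from an involution of the centraliser
    by an element of [H]. *)
Lemma maxE_self_cent g : g \in G -> g \in 'C(H) -> g \in H.
Proof.
move=> gG cHg; have [h hH hg2] := rcoset_meets_Ldiv2 gG.
have hG := subsetP maxE_sub h hH.
rewrite -(groupMl _ hH); apply: maxE_cent; rewrite ?groupM //.
by apply: (subsetP maxE_abelian).
Qed.

Lemma maxE_index_gt1 g : g \in G -> g \notin H -> 1 < #|H : 'C_H[g]|.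
Proof.
by move=> gG; rewrite ltnNge; apply: contra => /cent1H_index/maxE_self_cent->.
Qed.

(** Both sides count the commuting pairs in the product of [G] and [H]: for each
    coset [H :* g], its [#|H|] members centralise as many elements of [H] as
    there are involutions in the coset. *)
Lemma card_Ldiv2_cent : (#|H| * #|'Ldiv_2(G)|)%N = \sum_(h in H) #|'C_G[h]|.
Proof.
transitivity (\sum_(x in G) #|'C_H[x]|); last first.
  rewrite (eq_bigr (fun x => \sum_(h in H) (h \in 'C[x]))) => [|x _]; last first.
    rewrite -sum1_card big_mkcond [RHS]big_mkcond; apply: eq_bigr => h _.
    by rewrite in_setI; case: (h \in H) => //=; case: (h \in 'C[x]).
  rewrite exchange_big /=; apply: eq_bigr => h _.
  rewrite -sum1_card big_mkcond [RHS]big_mkcond; apply: eq_bigr => x _.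
  by rewrite in_setI; case: (x \in G) => //=; rewrite cent1C; case: (x \in _).
rewrite (partition_big (rcoset H) [in rcosets H G]) => [|x xG]; last first.
  by apply/rcosetsP; exists x; rewrite ?rcosetE.
rewrite card_Ldiv2_rcosets big_distrr /=; apply: eq_bigr => _ /rcosetsP[g gG ->].
have [h hH j2] := rcoset_meets_Ldiv2 gG; set j := h * g in j2.
have eqj : H :* g = H :* j.
  by apply/rcoset_eqP/rcosetP; exists h^-1; rewrite ?groupV // mulKg.
rewrite (eq_bigl [in H :* g]) => [|x]; last first.
  rewrite rcosetE (sameP eqP rcoset_eqP); apply: andb_idl => /rcosetP[k kH ->].
  by rewrite groupM // (subsetP maxE_sub).
rewrite (eq_bigr (fun=> #|'C_H[j]|)) => [|x]; last first.
  by rewrite eqj => /rcosetP[k kH ->]; rewrite rcoset_cent1.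
by rewrite sum_nat_const eqj Ldiv2_rcoset // !card_rcoset.
Qed.

End Cosets.

(** * Subgroups of index two *)


Section IndexTwo.

Variable gT : finGroupType.
Implicit Types (A G V : {group gT}) (x e u : gT).

Lemma index2_sdprod G A e : A \subset G -> #|G : A| = 2 ->
  e \in G -> e \notin A -> e ^+ 2 = 1 -> A ><| <[e]> = G /\ #[e] = 2.
Proof.
move=> sAG iGA eG eA e2; have oe : #[e] = 2.
  by apply: nt_prime_order => //; apply: contraNneq eA => ->; rewrite group1.
have nAG := normal_norm (index2_normal sAG iGA).
have tiAe : A :&: <[e]> = 1.
  by rewrite setIC prime_TIg -?orderE ?oe // cycle_subG.
split=> //; rewrite sdprodE //; last by rewrite cycle_subG (subsetP nAG).
apply/eqP; rewrite eqEcard mul_subG ?cycle_subG //= TI_cardMg //.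
by rewrite -orderE oe -(Lagrange sAG) iGA leqnn.
Qed.

Lemma index2_intro G A e : A \subset G -> e \in G -> e \notin A ->
  {in G, forall x, x \notin A -> e * x \in A} -> #|G : A| = 2.
Proof.
move=> sAG eG eA eGA; have defG : G :=: A :|: e^-1 *: A.
  apply/eqP; rewrite eqEsubset subUset sAG /=; apply/andP; split.
    apply/subsetP=> x xG; rewrite inE mem_lcoset invgK.
    by case: (boolP (x \in A)) => //= /(eGA x xG).
  by apply/subsetP=> _ /lcosetP[x xA ->]; rewrite groupM ?groupV ?(subsetP sAG x).
rewrite -divgS // defG cardsU card_lcoset (_ : _ :&: _ = set0) ?cards0 ?subn0.
  by rewrite addnn -mul2n mulnK ?cardG_gt0.
apply/setP=> x; rewrite !inE mem_lcoset invgK; apply/negP=> /andP[xA exA].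
by case/negP: eA; rewrite -(groupMr _ xA).
Qed.

Section Complement.

Variables (G A : {group gT}) (e : gT).
Hypotheses (defG : A ><| <[e]> = G) (oe : #[e] = 2).

Lemma sdprod2_card : #|G| = (2 * #|A|)%N.
Proof. by rewrite -(sdprod_card defG) -orderE oe mulnC. Qed.

Lemma sdprod2_sub : A \subset G.
Proof. by have [/normal_sub] := sdprod_context defG. Qed.

Lemma sdprod2_coset x : x \in G -> x \notin A -> x * e \in A.
Proof.
have e2 : e ^+ 2 = 1 by rewrite -oe expg_order.
have [_ <- _ _] := sdprodP defG; case/mulsgP=> a _ aA /cycleP[k ->] ->.
rewrite (divn_eq k 2) expgD mulnC expgM e2 expg1n mul1g modn2.
by case: (odd k); rewrite ?expg1 -mulgA -?expg2 ?e2 ?mulg1 // aA.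
Qed.

End Complement.

Lemma inverted_abelian A e : {in A, forall a, a ^ e = a^-1} -> abelian A.
Proof.
move=> inv; apply/centsP=> x xA y yA; apply: (can_inj (@invgK _)).
by rewrite -inv ?groupM // conjMg !inv // -invMg.
Qed.

Definition inverted_index2 G := exists (A : {group gT}) (e : gT),
  [/\ A ><| <[e]> = G, #[e] = 2 & {in A, forall a, a ^ e = a^-1}].

Definition abelem_index2 G := exists (V : {group gT}) (c : gT),
  [/\ V ><| <[c]> = G, #[c] = 2 & 2.-abelem V].

(** Otherwise translation by [u] would move the involutions, more than half of
    [G], off themselves. *)
Lemma Ldiv2_center G u : #|G| < 2 * #|'Ldiv_2(G)| ->
  u \in 'Z(G) -> u ^+ 2 = 1.
Proof.
move=> wallG /setIP[uG cGu]; apply/eqP/idPn => nu2; move: wallG; apply/negP.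
rewrite -leqNgt mul2n -addnn -{2}(card_lcoset 'Ldiv_2(G) u).
rewrite -cardsUI (_ : _ :&: (u *: _) = set0) ?cards0 ?addn0.
  apply: subset_leq_card; rewrite subUset subsetIl /=.
  by apply/subsetP=> _ /lcosetP[x /LdivP[xG _] ->]; apply: groupM.
apply/setP=> y; rewrite !inE; apply/negP=> /andP[/andP[_ y2]].
case/lcosetP=> x /LdivP[xG x2] defy.
case/negP: nu2; move: y2; rewrite defy expgMn ?x2 ?mulg1 //.
exact: (centP cGu).
Qed.

(** If a non-involution [u] commutes with every other non-involution, then every
    involution [x] either centralises [u] or has [u * x] an involution as well,
    hence inverts [u].  So ['C_G[u]] has index 2 and its complement consists of
    involutions, each of which inverts ['C_G[u]]. *)
Lemma inverted_index2_of_cent G u : #|G| < 2 * #|'Ldiv_2(G)| ->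
    u \in G -> u ^+ 2 != 1 ->
    {in G, forall x, x ^+ 2 != 1 -> commute x u} ->
  inverted_index2 G.
Proof.
move=> wallG uG u2 cu.
have inv x : x \in G -> x \notin 'C_G[u] -> x ^+ 2 = 1 /\ u ^ x = u^-1.
  move=> xG; rewrite inE xG /= => /cent1P ncxu.
  have x2 : x ^+ 2 = 1 by apply/eqP/idPn => /(cu x xG).
  split=> //; apply/(mul2_inverts u x2)/eqP/idPn => xu2; case: ncxu.
  have /commute_sym c := cu _ (groupM xG uG) xu2.
  by rewrite -(mulgK u x); apply/commute_sym/commuteM=> //; apply/commuteV.
have ntu : u != u^-1 by rewrite eq_sym eq_invg_mul -expg2.
have uZ : u \notin 'Z(G) by apply: contra u2 => /(Ldiv2_center wallG)->.
have iGC : #|G : 'C_G[u]| = 2.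
  rewrite index_cent1; apply/eqP; rewrite eqn_leq; apply/andP; split.
    have <- : #|[set u; u^-1]| = 2 by rewrite cards2 ntu.
    apply: subset_leq_card; apply/subsetP=> _ /imsetP[x xG ->].
    have [/setIP[_ /cent1P cxu]|/(inv x xG)[_ ->]] := boolP (x \in 'C_G[u]).
      by rewrite /conjg -cxu mulKg set21.
    exact: set22.
  rewrite ltnNge -index_cent1; apply: contra uZ => iG; rewrite inE uG /=.
  by rewrite -sub_cent1 -indexg_eq1 -indexgI eqn_leq iG indexg_gt0.
have /subsetPn[e eG eC] : ~~ (G \subset 'C_G[u]) by rewrite -indexg_eq1 iGC.
have [e2 _] := inv e eG eC.
have [defG oe] := index2_sdprod (subsetIl _ _) iGC eG eC e2.
exists 'C_G[u]%G, e; split=> // b bC; apply/(mul2_inverts b e2).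
have bG : b \in G by case/setIP: bC.
have [] // := inv (e * b) (groupM eG bG).
by rewrite -[_ \in _]/(e * b \in 'C_G[u]%G) groupMr.
Qed.

End IndexTwo.

(** * All involutions centralising the same hyperplane *)


(** Here all the involutions outside [H] centralise the same hyperplane [K] of
    [H], so that [K] is central, and [h] is an element of [H] outside [K].  The
    hypothesis [noncentral] says that [inverted_index2_of_cent] does not apply;
    it then turns out that [G] has an elementary abelian subgroup of index 2. *)
Section CommonHyperplane.

Variables (gT : finGroupType) (G H K : {group gT}) (h : gT).
Hypothesis maxH : H \in 'E*_2(G).
Hypothesis wallG : #|G| < 2 * #|'Ldiv_2(G)|.
Hypothesis iHK : #|H : K| = 2.
Hypothesis cHK : {in G, forall g, g \notin H -> 'C_H[g] = K}.
Hypotheses (hH : h \in H) (hK : h \notin K) (ltHG : H \proper G).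
Hypothesis noncentral :
  {in G, forall u, u ^+ 2 != 1 -> exists2 x, x \in G & x ^+ 2 != 1 /\ ~ commute x u}.
Implicit Types (x y u v : gT).

Let sHG : H \subset G := maxE_sub maxH.
Let H2 := maxE_sqr maxH.
Let h2 : h ^+ 2 = 1 := H2 hH.
Let hG : h \in G := subsetP sHG h hH.

Let sKH : K \subset H.
Proof.
by have [_ [x xG /(cHK xG) <-]] := properP ltHG; apply: subsetIl.
Qed.

Let K2 k : k \in K -> k ^+ 2 = 1.
Proof. by move/(subsetP sKH)/H2. Qed.

Let centK k x : k \in K -> x \in G -> commute k x.
Proof.
move=> kK xG; have [xH | xH] := boolP (x \in H).
  exact: (centsP (maxE_abelian maxH)) (subsetP sKH k kK) x xH.
by apply/cent1P; move: kK; rewrite -(cHK xG xH) => /setIP[].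
Qed.

Let Ksq k x : k \in K -> x \in G -> (k * x) ^+ 2 = x ^+ 2.
Proof. by move=> kK xG; rewrite expgMn ?(K2 kK) ?mul1g //; apply: centK. Qed.

Let hKH y : y \in H -> y \notin K -> h * y \in K.
Proof. by move=> yH; apply: index2_mul iHK hH yH hK. Qed.

Let cent_h x : x \in G -> commute h x -> x \in H.
Proof.
move=> xG chx; apply/idPn => xH; case/negP: hK; rewrite -(cHK xG xH) inE hH.
exact/cent1P.
Qed.

(** Since [H] is the union of [K] and [h *: K], the involution in the coset
    [H :* x] may be taken to be [x] or [h * x]. *)
Let mulh x : x \in G -> x ^+ 2 != 1 -> (h * x) ^+ 2 = 1.
Proof.
move=> xG; have [k kH kx2] := rcoset_meets_Ldiv2 maxH wallG xG.
have [kK | kK] := boolP (k \in K); first by rewrite -(Ksq kK xG) kx2 eqxx.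
move=> _; rewrite -(Ksq (hKH kH kK)) ?groupM //.
have -> // : h * k * (h * x) = k * x.
by rewrite (centsP (maxE_abelian maxH) h hH k kH) -mulgA (mulgA h) -expg2 h2 mul1g.
Qed.

Let inverts u : u \in G -> u ^+ 2 != 1 -> u ^ h = u^-1.
Proof. by move=> uG u2; apply/(mul2_inverts u h2)/mulh. Qed.

Let both_Ldiv2 x : x \in G -> x ^+ 2 = 1 -> (h * x) ^+ 2 = 1 -> x \in H.
Proof. by move=> xG x2 /(commute2 h2 x2); apply: cent_h. Qed.

(** Both [h] and its conjugate [h ^ g] invert every non-involution, hence
    [[~ h, g]] centralises all of them; by [noncentral] it is an involution.  If
    it were outside [K], some non-involution built from it would yield a
    contradiction with ['C_G[h] = H]. *)
Let comm_hK g : g \in G -> [~ h, g] \in K.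
Proof.
move=> gG; set m := [~ h, g]; have mG : m \in G by rewrite groupR.
have cm u : u \in G -> u ^+ 2 != 1 -> commute u m.
  move=> uG u2; apply/commgP/conjg_fixP; rewrite /m commgEl (invg2 h2) conjgM.
  rewrite inverts // conjVg; apply: (canLR (@invgK _)).
  have vG : u ^ g^-1 \in G by rewrite groupJ ?groupV.
  have /(inverts vG)/(congr1 (conjg^~ g)) : (u ^ g^-1) ^+ 2 != 1.
    by rewrite -conjXg conjg_eq1.
  by rewrite conjJg conjVg !conjgKV.
have m2 : m ^+ 2 = 1.
  by apply/eqP/idPn => /(noncentral mG)[x xG [/(cm x xG)]].
apply/idPn => mK; have [mH | mH] := boolP (m \in H).
  have /subsetPn[g1 g1G g1H] := proper_subn ltHG.
  have chg : ~ commute h g1 by move=> c; case/negP: g1H; apply: cent_h.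
  have [g12 | g12] := eqVneq (g1 ^+ 2) 1; last first.
    by case/negP: mK; rewrite -(cHK g1G g1H) inE mH; apply/cent1P/commute_sym/cm.
  have hg1G : h * g1 \in G by rewrite groupM.
  have hg1 : (h * g1) ^+ 2 != 1 by apply/eqP=> /(commute2 h2 g12).
  have hg1H : h * g1 \notin H by rewrite groupMl.
  by case/negP: mK; rewrite -(cHK hg1G hg1H) inE mH; apply/cent1P/commute_sym/cm.
have hm2 : (h * m) ^+ 2 != 1 by apply: contra mH => /eqP; apply: both_Ldiv2.
have /commute_sym c := cm _ (groupM hG mG) hm2.
case/negP: mH; apply: cent_h => //; apply/commute_sym.
by rewrite -(mulgK m h); apply: commuteM => //; apply: commuteV.
Qed.

Let sqr_comm u : u \in G -> u ^+ 2 != 1 -> u ^+ 2 = [~ h, u].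
Proof. by move=> uG u2; rewrite commgEr conjVg inverts // invgK. Qed.

Let sqr_K x : x \in G -> x ^+ 2 \in K.
Proof.
move=> xG; have [-> | x2] := eqVneq (x ^+ 2) 1; first exact: group1.
by rewrite sqr_comm // comm_hK.
Qed.

Let comm_K x y : x \in G -> y \in G -> [~ x, y] \in K.
Proof.
move=> xG yG; rewrite commg_sqrs.
have xyG : x * y^-1 \in G by rewrite groupM ?groupV.
by apply: groupM; [apply: groupM|]; rewrite ?groupV; apply: sqr_K.
Qed.

Let commMr x y z : x \in G -> y \in G -> z \in G ->
  [~ x, y * z] = [~ x, y] * [~ x, z].
Proof.
move=> xG yG zG; rewrite commgMJ; have cK := centK (comm_K xG yG).
by rewrite /conjg (cK z zG) mulKg -cK ?groupR.
Qed.

(** On non-involutions the squaring map is [u |-> [~ h, u]], which is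
    multiplicative; comparing with [(u * v) ^+ 2] ties the commutator of two
    non-involutions to whether their product is an involution. *)
Let comm_dichotomy u v : u \in G -> v \in G -> u ^+ 2 != 1 -> v ^+ 2 != 1 ->
  [~ u, v] = if (u * v) ^+ 2 == 1 then u ^+ 2 * v ^+ 2 else 1.
Proof.
move=> uG vG u2 v2; have cu2 := centK (sqr_K uG); have cv2 := centK (sqr_K vG).
case: eqVneq => [uv2 | uv2]; last first.
  have := sqr_comm (groupM uG vG) uv2; rewrite commMr // -!sqr_comm // !expg2.
  by rewrite !mulgA => /mulIg; rewrite -!mulgA => /mulgI/esym/commgP/eqP.
have cube x : x \in G -> x ^+ 2 * x = x^-1.
  by move=> xG; rewrite -{1}(invg2 (K2 (sqr_K xG))) expg2 invMg mulgKV.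
apply: (mulgI (v * u)); rewrite -commgC -mulgA.
have -> : u * v = v ^+ 2 * v * (u ^+ 2 * u) by rewrite !cube // -invMg invg2.
by rewrite -[LHS]mulgA (cu2 u uG) cv2 ?groupM ?groupX // !mulgA.
Qed.

(** By [comm_dichotomy] a non-involution [u] commutes with [v] but not with [w]
    when [u * v] is not an involution and [u * w] is one.  Whichever of [v * w]
    and [h * (v * w)] is a non-involution, [comm_dichotomy] for it and [u]
    forces [w], [v] or [u * v] to be an involution. *)
Let comm_conflict u v w : u \in G -> v \in G -> w \in G ->
    u ^+ 2 != 1 -> v ^+ 2 != 1 -> w ^+ 2 != 1 ->
  [~ u, w] != 1 -> u * v \notin H -> (u * v) ^+ 2 = 1.
Proof.
move=> uG vG wG u2 v2 w2 uw1 uvH; apply/eqP/idPn => uv2.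
have uv1 : [~ u, v] = 1 by rewrite comm_dichotomy // (negPf uv2).
have [vwG hvwG] : v * w \in G /\ h * (v * w) \in G by rewrite !groupM.
have uw2 : (u * w) ^+ 2 = 1.
  by apply/eqP; apply: contraNT uw1 => /negPf uw2; rewrite comm_dichotomy // uw2.
have cuw : [~ u, w] = u ^+ 2 * w ^+ 2 by rewrite comm_dichotomy // uw2 eqxx.
have [vw2 | vw2] := eqVneq ((v * w) ^+ 2) 1; last first.
  have vw1 : [~ v, w] = 1 by rewrite comm_dichotomy // (negPf vw2).
  have := comm_dichotomy uG vwG u2 vw2; rewrite commMr // uv1 mul1g.
  case: ifP => _ => [|/eqP]; last exact/negP.
  rewrite cuw => /mulgI /esym; rewrite expgMn; last by apply/commgP/eqP.
  by rewrite -{2}(mul1g (w ^+ 2)) => /mulIg/eqP; apply/negP.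
have hvw2 : (h * (v * w)) ^+ 2 != 1.
  apply/eqP=> hvw2; have vwH := both_Ldiv2 vwG vw2 hvw2.
  have [vwK | vwK] := boolP (v * w \in K); last first.
    have : (h * (v * w) * w^-1) ^+ 2 = 1 by rewrite -!mulgA mulgV mulg1 mulh.
    by rewrite Ksq ?groupV ?hKH // expgVn => /eqP; rewrite invg_eq1; apply/negP.
  have wVG : w^-1 \in G by rewrite groupV.
  have uvE : u * v = v * w * (u * w^-1).
    by rewrite mulgA (centK vwK uG) -!mulgA mulgV mulg1.
  have uwE : u * w = w ^+ 2 * (u * w^-1).
    by rewrite mulgA (centK (sqr_K wG) uG) -mulgA expg2 -mulgA mulgV mulg1.
  have uwVG : u * w^-1 \in G by rewrite groupM.
  by case/eqP: uv2; rewrite uvE Ksq // -(Ksq (sqr_K wG)) // -uwE.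
have := comm_dichotomy uG hvwG u2 hvw2.
rewrite 2?commMr // cuw uv1 mul1g (sqr_comm hvwG hvw2) 2?commMr // commgg mul1g.
rewrite -!sqr_comm // -[[~ u, h]]invgK invg_comm -sqr_comm // (invg2 (K2 (sqr_K uG))).
rewrite mulgA -{1}expg2 (K2 (sqr_K uG)) mul1g mulgA.
case: ifP => _ => [|/eqP]; last exact/negP.
rewrite -{1}(mul1g (w ^+ 2)) (mulgA (u ^+ 2)) => /mulIg/esym.
rewrite -expgMn; last by apply/commgP/eqP.
by move/eqP; apply/negP.
Qed.

Let mul_Ldiv2 u v : u \in G -> v \in G -> u ^+ 2 != 1 -> v ^+ 2 != 1 ->
  u * v \notin H -> (u * v) ^+ 2 = 1.
Proof.
move=> uG vG u2 v2; have [w wG [w2 ncwu]] := noncentral uG u2.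
by apply: comm_conflict wG _ _ _ _ => //; apply/commgP=> /commute_sym.
Qed.

(** Apart from [K], this is the translate by [h] of the set of non-involutions.
    It consists of involutions by [mulh], and it is closed under products
    because the product of two non-involutions is an involution or lies in
    [H]. *)
Let V : {set gT} := [set x in G | (x \in K) || ((h * x) ^+ 2 != 1)].

Let memK_V k : k \in K -> k \in V.
Proof. by move=> kK; rewrite inE (subsetP sHG) ?(subsetP sKH) ?kK. Qed.

Let V_group_set : group_set V.
Proof.
have KV k x : k \in K -> x \in V -> k * x \in V.
  move=> kK; rewrite !inE => /andP[xG].
  have kG : k \in G by rewrite (subsetP sHG) ?(subsetP sKH).
  by rewrite groupM // groupMl // mulgA -(centK kK hG) -mulgA (Ksq kK) ?groupM.
apply/group_setP; split=> [|x y]; first by rewrite memK_V.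
move=> xV yV; have [[xG _] [yG _]] := (setIdP xV, setIdP yV).
have [xK | xK] := boolP (x \in K); first exact: KV.
have [yK | yK] := boolP (y \in K); first by rewrite -(centK yK xG) KV.
have [hx2 hy2] : (h * x) ^+ 2 != 1 /\ (h * y) ^+ 2 != 1.
  by move: xV yV; rewrite !inE (negPf xK) (negPf yK) /= => /andP[_ ->] /andP[_ ->].
have [hxG hyG] : h * x \in G /\ h * y \in G by rewrite !groupM.
have xyG : x * y \in G by rewrite groupM.
have x2 : x ^+ 2 = 1 by rewrite -(mulKg h x) (invg2 h2) mulh.
have xyE : x * y = (h * x)^-1 * (h * y) by rewrite invMg (invg2 x2) mulgA mulgKV.
have [xyH | xyH] := boolP (x * y \in H).
  have [/memK_V // | xyK] := boolP (x * y \in K).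
  case/eqP: hy2; rewrite -(mulKVg (h * x) (h * y)) -xyE.
  have kK := hKH xyH xyK.
  have -> : h * x * (x * y) = x ^ h * (h * (x * y)).
    rewrite /conjg invg2 // -!mulgA; congr (h * (x * _)).
    by rewrite mulgA -expg2 h2 mul1g.
  by rewrite -(centK kK) ?groupJ // Ksq ?groupJ // -conjXg x2 conj1g.
have uvE : h * x * (h * y) = (h * x) ^+ 2 * (x * y).
  by rewrite xyE expg2 -[RHS]mulgA mulKVg.
have xy2 : (x * y) ^+ 2 = 1.
  rewrite -(Ksq (sqr_K hxG)) // -uvE mul_Ldiv2 // uvE.
  by rewrite groupMl // (subsetP sKH) ?sqr_K.
by rewrite inE xyG; apply/orP; right; apply: contra xyH => /eqP; apply: both_Ldiv2.
Qed.

Lemma abelem_index2_of_noncentral : abelem_index2 G.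
Proof.
have hV : h \notin V by rewrite inE hG (negPf hK) -expg2 h2 expg1n eqxx.
have sVG : group V_group_set \subset G by apply/subsetP=> x /setIdP[].
have iV : #|G : group V_group_set| = 2.
  apply: (index2_intro sVG hG hV) => x xG.
  rewrite /= !inE xG groupM // mulgA -expg2 h2 mul1g /= negb_or negbK.
  case/andP=> xK /eqP hx2; have [x2 | //] := eqVneq (x ^+ 2) 1; last by rewrite orbT.
  by rewrite orbF hKH // both_Ldiv2.
have [defG oh] := index2_sdprod sVG iV hG hV h2.
exists (group V_group_set), h; split=> //; apply: exponent2_abelem.
apply/exponentP=> x /setIdP[xG /orP[/K2 // | hx2]].
by rewrite -(mulKg h x) (invg2 h2) mulh // groupM.
Qed.

End CommonHyperplane.

Lemma common_hyperplane (gT : finGroupType) (G H K : {group gT}) :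
    H \in 'E*_2(G) -> #|G| < 2 * #|'Ldiv_2(G)| -> H \proper G -> #|H : K| = 2 ->
    {in G, forall g, g \notin H -> 'C_H[g] = K} ->
  inverted_index2 G \/ abelem_index2 G.
Proof.
move=> maxH wallG ltHG iHK cHK.
have [h hH hK] : exists2 h, h \in H & h \notin K.
  by apply/subsetPn; rewrite -indexg_eq1 iHK.
have [/exists_inP[u uG /andP[u2 /forall_inP cu]] | none] :=
  boolP [exists u in G, (u ^+ 2 != 1)
    && [forall x in G, (x ^+ 2 != 1) ==> (x * u == u * x)]].
  left; apply: inverted_index2_of_cent u2 _ => // x xG x2.
  exact/eqP/(implyP (cu x xG)).
right; apply: abelem_index2_of_noncentral cHK hH hK ltHG _ => // u uG u2.
have: ~~ [forall x in G, (x ^+ 2 != 1) ==> (x * u == u * x)].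
  by apply: contra none => cu; apply/exists_inP; exists u; rewrite ?u2.
rewrite negb_forall_in => /exists_inP[x xG]; rewrite negb_imply => /andP[x2 /eqP].
by exists x.
Qed.

(** * Involutions centralising different hyperplanes *)


(** When ['C_H[g]] has index at most 2 in [H], the map [moves g] is a linear
    functional on [H], seen as a vector space over the field of two elements.
    If two of these functionals are different and nonzero, [moves] is additive
    in [g] as well; so [G] acts on [H] as a group of transvections with distinct
    axes, and such transvections share their centre. *)
Section Transvections.

Variables (gT : finGroupType) (G H : {group gT}).
Hypothesis maxH : H \in 'E*_2(G).
Hypothesis wallG : #|G| < 2 * #|'Ldiv_2(G)|.
Implicit Types (g y z x w : gT).

Definition moves g x := [~ x, g] != 1.

Lemma movesPn g x : reflect (commute x g) (~~ moves g x).
Proof. by rewrite negbK; apply: commgP. Qed.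

Lemma moves_fixl g y x : ~~ moves g x -> moves (g * y) x = moves y x.
Proof.
move=> /movesPn cxg; apply: negb_inj; apply/movesPn/movesPn=> cx.
  by rewrite -(mulKg g y); apply: commuteM => //; apply: commuteV.
exact: commuteM.
Qed.

Lemma moves_fixr g y x : ~~ moves y x -> moves (g * y) x = moves g x.
Proof.
move=> /movesPn cxy; apply: negb_inj; apply/movesPn/movesPn=> cx.
  by rewrite -(mulgK y g); apply: commuteM => //; apply: commuteV.
exact: commuteM.
Qed.

Lemma cent1_moves g w : w \in H -> (w \in 'C_H[g]) = ~~ moves g w.
Proof. by move=> wH; rewrite inE wH; apply/cent1P/movesPn. Qed.

Lemma movesM g : #|H : 'C_H[g]| <= 2 ->
  {in H &, forall x y, moves g (x * y) = moves g x (+) moves g y}.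
Proof.
move=> iHg x y xH yH; have memC := cent1_moves g.
have [xC | xC] := boolP (x \in 'C_H[g]).
  have -> : moves g x = false by apply: negbTE; rewrite -memC.
  by apply: negb_inj; rewrite -(memC _ (groupM xH yH)) -memC //; apply: groupMl.
have [yC | yC] := boolP (y \in 'C_H[g]).
  have -> : moves g y = false by apply: negbTE; rewrite -memC.
  rewrite addbF; apply: negb_inj; rewrite -(memC _ (groupM xH yH)) -memC //.
  exact: groupMr.
have iH2 : #|H : 'C_H[g]| = 2.
  apply/eqP; rewrite eqn_leq iHg ltnNge; apply: contra xC => /cent1H_index cg.
  by rewrite inE xH; apply/cent1P/commute_sym/(centP cg).
have := index2_mul (subsetIl _ _) iH2 xH yH xC yC.
rewrite memC ?groupM // => /negPf->.
by move: xC yC; rewrite !memC // !negbK => -> ->.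
Qed.

Lemma nontrivial_moves g : g \in G -> g \notin H -> exists2 x, x \in H & moves g x.
Proof.
move=> gG gH; apply/exists_inP; apply: contraR gH => /exists_inPn fix_g.
apply: (maxE_self_cent maxH wallG gG); apply/centP=> x xH.
exact/commute_sym/movesPn/fix_g.
Qed.

Lemma moves_fixed_mem g : g \in G -> {in H, forall x, ~~ moves g x} -> g \in H.
Proof.
move=> gG fix_g; apply/idPn => /(nontrivial_moves gG)[x xH].
by rewrite (negPf (fix_g x xH)).
Qed.

Hypothesis iH2 : {in G, forall g, #|H : 'C_H[g]| <= 2}.

Let movesMr g x y : g \in G -> x \in H -> y \in H ->
  moves g (x * y) = moves g x (+) moves g y.
Proof. by move=> gG; apply/movesM/iH2. Qed.

(** If [g] and [y] both move [x], multiplying [x] by a vector [w] which only one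
    of them moves reduces to the case of [moves_fixl] or [moves_fixr]. *)
Let moves_addb_neq g y w : g \in G -> y \in G -> w \in H ->
    moves g w != moves y w ->
  {in H, forall x, moves (g * y) x = moves g x (+) moves y x}.
Proof.
move=> gG yG wH neq x xH; have gyG := groupM gG yG.
case gx: (moves g x); last by rewrite moves_fixl ?gx.
case yx: (moves y x); last by rewrite moves_fixr ?gx ?yx.
have /esym := movesMr gyG xH wH.
move: neq; case gw: (moves g w); case yw: (moves y w) => // _.
  rewrite (@moves_fixl g y (x * w)); last by rewrite movesMr // gx gw.
  rewrite (@moves_fixr g y w) ?yw // movesMr // gw yx yw.
  by case: (moves _ x).
rewrite (@moves_fixr g y (x * w)); last by rewrite movesMr // yx yw.
rewrite (@moves_fixl g y w) ?gw // movesMr // gx gw yw.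
by case: (moves _ x).
Qed.

Variables a b : gT.
Hypotheses (aG : a \in G) (bG : b \in G) (aH : a \notin H) (bH : b \notin H).
Hypothesis ab_diff : 'C_H[a] != 'C_H[b].

Let differ g y := [exists x in H, moves g x != moves y x].

Let differPn g y : reflect {in H, moves g =1 moves y} (~~ differ g y).
Proof.
apply: (iffP exists_inPn) => eq_gy x xH; last by rewrite eq_gy ?eqxx.
by move: (eq_gy x xH); rewrite negbK => /eqP.
Qed.

Let differ_ab : differ a b.
Proof.
apply: contraR ab_diff => /differPn eq_ab; apply/eqP/setP=> x; rewrite !(in_setI).
case xH: (x \in H) => //=; apply/cent1P/cent1P=> /movesPn; rewrite ?eq_ab //.
  by move/movesPn.
by rewrite -eq_ab // => /movesPn.
Qed.

Let differ_other g : exists z, [/\ z \in G, z \notin H & differ g z].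
Proof.
have [ga | /differPn ga] := boolP (differ g a); first by exists a.
exists b; split=> //; case/exists_inP: differ_ab => x xH neq.
by apply/exists_inP; exists x; rewrite ?ga.
Qed.

(** Two nonzero functionals on [H] over the field of two elements which differ
    have incomparable kernels. *)
Let differ_sep g z : g \in G -> z \in G -> g \notin H -> differ g z ->
  exists2 x, x \in H & moves g x && ~~ moves z x.
Proof.
move=> gG zG gH /exists_inP[w wH neq].
case gw: (moves g w) neq => [|].
  by case zw: (moves z w) => // _; exists w; rewrite ?gw ?zw.
rewrite eq_sym eqbF_neg negbK => zw; have [v vH gv] := nontrivial_moves gG gH.
case zv: (moves z v); last by exists v; rewrite ?gv ?zv.
by exists (v * w); rewrite ?groupM ?movesMr // gv gw zv zw.
Qed.

Let differ_sym g z : differ g z = differ z g.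
Proof. by apply: eq_existsb => x; rewrite eq_sym. Qed.

(** When [g] and [y] define the same functional, a third one, defined by [z], is
    used: the functional of [g * (y * z)] is then that of [z], which leaves only
    the zero functional for [g * y]. *)
Lemma moves_addb g y : g \in G -> y \in G ->
  {in H, forall x, moves (g * y) x = moves g x (+) moves y x}.
Proof.
move=> gG yG; have [/exists_inP[w] | /differPn eq_gy] := boolP (differ g y).
  exact: moves_addb_neq.
move=> x xH; rewrite eq_gy // addbb; have [z [zG zH gz]] := differ_other g.
case gx: (moves y x); last by rewrite moves_fixr ?gx // eq_gy.
have [w wH zw] := nontrivial_moves zG zH.
have [v vH /andP[zv gv]] : exists2 x, x \in H & moves z x && ~~ moves g x.
  by apply: differ_sep; rewrite // differ_sym.
have yz : {in H, forall x, moves (y * z) x = moves y x (+) moves z x}.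
  by move=> t; apply: (moves_addb_neq (w := v)) => //; rewrite -eq_gy // zv (negPf gv).
have := moves_addb_neq (groupM gG yG) zG vH _ xH.
rewrite moves_fixl // -eq_gy // (negPf gv) zv => /(_ isT).
have -> : moves (g * y * z) x = moves z x.
  rewrite -mulgA (moves_addb_neq (w := w)) ?groupM //.
    by rewrite yz // eq_gy // addKb.
  by rewrite yz // eq_gy // zw addbT -addbT; case: (moves y w).
by case: (moves z x); case: (moves _ x).
Qed.

Let moves_H y : y \in H -> {in H, forall x, moves y x = false}.
Proof.
by move=> yH x xH; apply/negbTE/movesPn/(centsP (maxE_abelian maxH)).
Qed.

Let sHG : H \subset G := maxE_sub maxH.

Let normH : G \subset 'N(H).
Proof.
apply/subsetP=> g gG; rewrite inE; apply/subsetP=> _ /imsetP[y yH ->].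
have yG := subsetP sHG y yH.
apply: moves_fixed_mem; rewrite ?groupJ // => x xH.
rewrite /conjg moves_addb ?groupV ?groupM // moves_addb // (moves_H yH) //=.
by rewrite -(moves_addb (groupVr gG) gG xH) mulVg moves_H ?group1.
Qed.

Let sqrH g : g \in G -> g ^+ 2 \in H.
Proof.
move=> gG; apply: moves_fixed_mem; rewrite ?groupX // => x xH.
by rewrite expg2 moves_addb // addbb.
Qed.

Let H2 := maxE_sqr maxH.
Let cHH := centsP (maxE_abelian maxH).

Let commgH g x : x \in H -> [~ x, g] = x * x ^ g.
Proof. by move=> xH; rewrite commgEl invg2 ?H2. Qed.

Let conjH g x : g \in G -> x \in H -> x ^ g \in H.
Proof. by move=> gG xH; rewrite memJ_norm // (subsetP normH). Qed.

Let comm_fixed g x : g \in G -> x \in H -> [~ x, g] ^ g = [~ x, g].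
Proof.
move=> gG xH; rewrite commgH // conjMg -conjgM -expg2.
have -> : x ^ (g ^+ 2) = x by apply/conjg_fixP/commgP/cHH => //; apply: sqrH.
by apply: cHH => //; apply: conjH.
Qed.

Let comm_H g x : g \in G -> x \in H -> [~ x, g] \in H.
Proof. by move=> gG xH; rewrite commgH // groupM ?conjH. Qed.

Let comm_moved g x y : g \in G -> x \in H -> y \in H -> moves g x -> moves g y ->
  [~ x, g] = [~ y, g].
Proof.
move=> gG xH yH gx gy.
have : ~~ moves g (x * y) by rewrite movesMr // gx gy.
rewrite negbK => /conjg_fixP; rewrite conjMg => exy.
rewrite !commgH // (canRL (mulgK _) exy) -conjVg invg2 ?H2 //.
by rewrite !mulgA -(expg2 x) H2 // mul1g.
Qed.

(** The centre of the transvection of [g * y] is read off at a vector moved by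
    [g] alone and at one moved by [y] alone. *)
Let comm_differ g y x w : g \in G -> y \in G -> x \in H -> w \in H ->
  differ g y -> moves g x -> moves y w -> [~ x, g] = [~ w, y].
Proof.
move=> gG yG xH wH gy gx yw.
have gH : g \notin H by apply: contraTN gx => gH; rewrite moves_H.
have yH : y \notin H by apply: contraTN yw => yH; rewrite moves_H.
have [x1 x1H /andP[gx1 yx1]] := differ_sep gG yG gH gy.
rewrite differ_sym in gy; have [x2 x2H /andP[yx2 gx2]] := differ_sep yG gG yH gy.
rewrite (comm_moved gG xH x1H) // (comm_moved yG wH x2H) //.
have e1 : [~ x1, g * y] = [~ x1, g] ^ y.
  rewrite commgMJ; move/movesPn/commgP/eqP: yx1 => ->; exact: mul1g.
have e2 : [~ x2, g * y] = [~ x2, y].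
  by rewrite commgMJ; move/movesPn/commgP/eqP: gx2 => ->; rewrite conj1g mulg1.
apply: (can_inj (conjgK y)); rewrite comm_fixed // -e1 -e2.
apply: comm_moved; rewrite ?groupM // moves_addb //.
  by rewrite gx1 (negPf yx1).
by rewrite yx2 (negPf gx2).
Qed.

(** The common centre [z] of the transvections is fixed by all of them.  As every
    element is the product of an [h] in [H] and an involution [j], its square is
    [[~ h, j]], which is 1 or [z]. *)
Lemma transvections_sqr_central : exists2 z, z \in 'Z(G) & z ^+ 2 = 1 /\
  {in G, forall x, x ^+ 2 = 1 \/ x ^+ 2 = z}.
Proof.
have [xa xaH ma] := nontrivial_moves aG aH.
have [xb xbH mb] := nontrivial_moves bG bH.
pose z := [~ xa, a]; have zH : z \in H by apply: comm_H.
have commz g x : g \in G -> x \in H -> moves g x -> [~ x, g] = z.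
  move=> gG xH gx; have [ga | /differPn ga] := boolP (differ g a).
    exact: comm_differ.
  have -> : z = [~ xb, b] by apply: comm_differ.
  apply: comm_differ => //; case/exists_inP: differ_ab => w wH neq.
  by apply/exists_inP; exists w; rewrite ?ga.
exists z.
  rewrite inE (subsetP sHG) //=; apply/centP=> g gG.
  have [gH | gH] := boolP (g \in H); first exact: cHH.
  have [x xH gx] := nontrivial_moves gG gH; rewrite -(commz g x) //.
  exact/commgP/conjg_fixP/comm_fixed.
split=> [|x xG]; first exact: H2.
have [h hH hx2] := rcoset_meets_Ldiv2 maxH wallG xG.
have hxG : h * x \in G by rewrite groupM // (subsetP sHG).
have -> : x ^+ 2 = [~ h, h * x].
  have hh w : h * (h * w) = w by rewrite mulgA -expg2 H2 // mul1g.
  by rewrite commgH // /conjg (invg2 hx2) hh -mulgA hh.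
have [hx | ] := boolP (moves (h * x) h); last by rewrite negbK => /eqP; left.
by right; apply: commz.
Qed.

End Transvections.

(** * An exceptional coset *)


Lemma index_le2 (gT : finGroupType) (H K : {group gT}) : K \subset H ->
    (forall x y, x \in H -> y \in H -> x \notin K -> y \notin K -> x * y \in K) ->
  #|H : K| <= 2.
Proof.
move=> sKH mulHK; have [sHK | /subsetPn[e eH eK]] := boolP (H \subset K).
  by rewrite (eqP (_ : #|H : K| == 1%N)) // indexg_eq1.
by rewrite (index2_intro sKH eH eK) // => x xH; apply: mulHK.
Qed.

(** Two commuting pairs of involutions, each pair with a central commutator,
    which together with the centre generate [G]. *)
Definition commuting_pairs (gT : finGroupType) (G : {group gT}) :=
  exists h1 a h2 b : gT,
  [/\ [/\ h1 \in G, a \in G, h2 \in G & b \in G],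
      [/\ h1 ^+ 2 = 1, a ^+ 2 = 1, h2 ^+ 2 = 1 & b ^+ 2 = 1],
      [/\ commute h1 h2, commute h1 b, commute a h2 & commute a b],
      [/\ [~ h1, a] \in 'Z(G), [~ h2, b] \in 'Z(G), [~ h1, a] != 1,
          [~ h2, b] != 1 & [~ h1, a] != [~ h2, b]] &
      G \subset 'Z(G) <*> <<[set h1; a]>> <*> <<[set h2; b]>>].

(** The element [e] is an involution of the exceptional coset: all the elements
    outside [H :* e] act on [H] as functionals in the sense of [movesM], while
    the fixed points of [e] have index at least 4. *)
Section ExceptionalCoset.

Variables (gT : finGroupType) (G H : {group gT}) (e : gT).
Hypothesis maxH : H \in 'E*_2(G).
Hypothesis wallG : #|G| < 2 * #|'Ldiv_2(G)|.
Hypotheses (eG : e \in G) (e2 : e ^+ 2 = 1) (ie : 2 < #|H : 'C_H[e]|).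
Implicit Types (g x y w u k : gT).

Let sHG : H \subset G := maxE_sub maxH.
Let H2 := maxE_sqr maxH.
Let cHH := centsP (maxE_abelian maxH).

Let eK : e^-1 = e := invg2 e2.

Let indexH x : x \in G -> x \notin H :* e -> #|H : 'C_H[x]| <= 2.
Proof.
by move=> xG; rewrite leqNgt; apply: contra; apply: rcoset_index_gt2_uniq eG xG ie.
Qed.

Let movesE := @cent1_moves gT H.

(** The elements [e] and [e * h] have the same centraliser in [H], so they lie in
    the same, unique exceptional coset. *)
Let eNH h : h \in H -> h ^ e \in H.
Proof.
move=> hH; have hG := subsetP sHG h hH.
have : e * h \in H :* e.
  by apply: (rcoset_index_gt2_uniq maxH wallG); rewrite ?groupM ?(lcoset_cent1 maxH).
by rewrite mem_rcoset eK /conjg eK mulgA.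
Qed.

Let T x := (x \in H) || (x \in H :* e).

Lemma exceptional_index2 : {in G, forall x, T x} -> abelem_index2 G.
Proof.
move=> GT; have eH : e \notin H.
  apply: contraL ie => eH; rewrite -(mulg1 e) (rcoset_cent1 maxH) //.
  by rewrite (setIidPl _) ?indexgg // cent11T subsetT.
have iH : #|G : H| = 2.
  apply: (index2_intro sHG eG eH) => x /GT/orP[-> // | /rcosetP[h hH ->] _].
  by have := eNH hH; rewrite /conjg eK.
have [defG oe] := index2_sdprod sHG iH eG eH e2.
exists H, e; split=> //; apply: exponent2_abelem; apply/exponentP; exact: H2.
Qed.

Let TN x : T (x * e) = T x.
Proof. by rewrite /T !mem_rcoset mulgK eK orbC. Qed.

Let notT g : ~~ T g -> g \notin H /\ g \notin H :* e.
Proof. by move/norP. Qed.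

Let movesMT g : g \in G -> ~~ T g ->
  {in H &, forall x y, moves g (x * y) = moves g x (+) moves g y}.
Proof. by move=> gG /notT[_ gHe]; apply/movesM/indexH. Qed.

Let moves_e_index g : g \in G -> ~~ T g ->
  ~ {in H, forall x, moves e x -> moves g x}.
Proof.
move=> gG nTg eg; have [_ gHe] := notT nTg; move: ie; apply/negP; rewrite -leqNgt.
apply: leq_trans (indexH gG gHe); apply: dvdn_leq => //.
apply: indexgS; apply/subsetP=> x xC.
have xH : x \in H by case/setIP: xC.
by move: xC; rewrite !movesE //; apply/contra/eg.
Qed.

(** A vector fixed by both [g] and [g * e] is fixed by [e].  If [g], hence
    [g * e], moved a fixed point [u] of [e], adding [u] would show the same for
    the vectors moved by both; then ['C_H[e]] would contain the hyperplane on
    which [moves g] and [moves (g * e)] agree. *)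
Let fix_e_fix g : g \in G -> ~~ T g -> {in H, forall u, ~~ moves e u -> ~~ moves g u}.
Proof.
move=> gG nTg u uH eu; apply/negP=> gu; move: ie; apply/negP; rewrite -leqNgt.
have [geG geT] : g * e \in G /\ ~~ T (g * e) by rewrite groupM ?TN.
have mg := movesMT gG nTg; have mge := movesMT geG geT.
have geu : moves (g * e) u by rewrite moves_fixr.
have fix00 x : x \in H -> moves g x = moves (g * e) x -> x \in 'C_H[e].
  move=> xH; case gx: (moves g x) => /esym gex; last first.
    by rewrite movesE // -(moves_fixl e (g := g)) ?gx // gex.
  have xuH : x * u \in H by rewrite groupM.
  have uC : u \in 'C_H[e] by rewrite movesE.
  rewrite -(groupMr _ uC) movesE // -(moves_fixl e (g := g)) ?mge ?mg ?gx ?gu //.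
  by rewrite gex geu.
have nfix x : x \in H -> x \notin 'C_H[e] -> moves g x = ~~ moves (g * e) x.
  move=> xH; apply: contraNeq => /negPf neq; apply: fix00 => //.
  by move: neq; case: moves; case: moves.
apply: index_le2 (subsetIl _ _) _ => x y xH yH xC yC.
apply: fix00; rewrite ?groupM // mg // mge // !nfix //.
by case: (moves _ x); case: (moves _ y).
Qed.

Lemma exceptional_fix_central u : u \in 'C_H[e] -> u \in 'Z(G).
Proof.
move=> uC; have /setIP[uH _] := uC; rewrite inE (subsetP sHG) //=.
apply/centP=> g gG; have [/orP[gH|/rcosetP[h hH ->]] | nTg] := boolP (T g).
- exact: cHH.
- by apply: commuteM; [apply: cHH | apply/cent1P; case/setIP: uC].
by apply/movesPn/(fix_e_fix gG nTg) => //; rewrite -movesE.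
Qed.

Let moves_eE g x : g \in G -> ~~ T g -> x \in H ->
  moves e x = moves g x || moves (g * e) x.
Proof.
move=> gG nTg xH; have [geG geT] : g * e \in G /\ ~~ T (g * e) by rewrite groupM ?TN.
case gx: (moves g x) => /=; last by rewrite moves_fixl ?gx.
apply: contraTT gx; exact: fix_e_fix.
Qed.

Let comm_e x : x \in H -> x * x ^ e \in 'C_H[e].
Proof.
move=> xH; rewrite inE groupM ?eNH //=; apply/cent1P/commgP/conjg_fixP.
by rewrite conjMg -conjgM -expg2 e2 conjg1; apply: cHH; rewrite ?eNH.
Qed.

Let separate g : g \in G -> ~~ T g ->
  exists2 x, x \in H & ~~ moves g x && moves (g * e) x.
Proof.
move=> gG nTg; apply/exists_inP; apply: contraT => /exists_inPn none.
case: (moves_e_index gG nTg) => x xH ex; apply: contraT => gx.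
by move: (none x xH); rewrite gx moves_fixl // ex.
Qed.

(** The kernels of [moves g] and [moves (g * e)] generate [H], and under these
    hypotheses [w * g^-1] centralises both. *)
Let same_coset g w : g \in G -> w \in G -> ~~ T g ->
    {in H, moves w =1 moves g} -> {in H, moves (w * e) =1 moves (g * e)} ->
  w * g^-1 \in H.
Proof.
move=> gG wG nTg eq1 eq2.
have [geG nTge] : g * e \in G /\ ~~ T (g * e) by rewrite groupM ?TN.
have fix1 x : x \in H -> ~~ moves g x -> commute x (w * g^-1).
  move=> xH gx; have wx : ~~ moves w x by rewrite eq1.
  by apply: commuteM; [apply/movesPn | apply/commuteV/movesPn].
have fix2 x : x \in H -> ~~ moves (g * e) x -> commute x (w * g^-1).
  move=> xH gx; have wx : ~~ moves (w * e) x by rewrite eq2.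
  have -> : w * g^-1 = w * e * (g * e)^-1 by rewrite invMg mulgA mulgK.
  by apply: commuteM; [apply/movesPn | apply/commuteV/movesPn].
apply: (moves_fixed_mem maxH wallG) => [|x xH]; first by rewrite groupM ?groupV.
apply/movesPn; have [gx | gx] := boolP (moves g x); last exact: fix1.
have [gex | gex] := boolP (moves (g * e) x); last exact: fix2.
have [y yH /andP[gy gey]] := separate gG nTg.
rewrite -(mulgK y x); apply/commute_sym; apply: commuteM.
  apply/commute_sym/fix2; rewrite ?groupM //.
  by rewrite (movesMT geG nTge) // gex gey.
by apply/commuteV/commute_sym/fix1.
Qed.

(** [same_coset] applies to [w = g * h] for [h] in [H]. *)
Let normH : G \subset 'N(H).
Proof.
have eN : e \in 'N(H).
  rewrite inE; apply/subsetP=> _ /imsetP[h hH ->]; exact: eNH.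
apply/subsetP=> g gG; have [/orP[gH | /rcosetP[h hH ->]] | nTg] := boolP (T g).
- exact: (subsetP (normG H)).
- by rewrite groupM // (subsetP (normG H)).
rewrite -groupV inE; apply/subsetP=> _ /imsetP[h hH ->].
rewrite /conjg invgK mulgA; have hG := subsetP sHG h hH.
apply: same_coset => // [|x xH|x xH]; first by rewrite groupM.
  by rewrite moves_fixr //; apply/movesPn/cHH.
rewrite -mulgA (conjgC h e) mulgA [LHS]moves_fixr //.
by apply/movesPn/cHH; rewrite ?eNH.
Qed.

Let sqrH x : x \in G -> x ^+ 2 \in H.
Proof.
move=> xG; have [h hH hx2] := rcoset_meets_Ldiv2 maxH wallG xG.
have hG := subsetP sHG h hH.
have -> : x ^+ 2 = h^-1 * h ^ (h * x).
  by rewrite /conjg (invg2 hx2) (mulgA h h) -(expg2 h) (H2 hH) mul1g -mulgA mulKg.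
by rewrite groupM ?groupV // memJ_norm // (subsetP normH) ?groupM.
Qed.

Let kernel_moves g w : g \in G -> w \in G -> ~~ T g -> ~~ T w ->
    {in H, forall x, ~~ moves g x -> ~~ moves w x} ->
  {in H, moves w =1 moves g}.
Proof.
move=> gG wG nTg nTw sub x xH; have [wH _] := notT nTw.
case gx: (moves g x); last by apply/negbTE/sub; rewrite ?gx.
have [y yH wy] := nontrivial_moves maxH wallG wG wH.
have gy : moves g y by apply: contraTT wy; apply: sub.
have : ~~ moves w (x * y).
  by apply: sub; rewrite ?groupM // (movesMT gG nTg) // gx gy.
by rewrite (movesMT wG nTw) // wy addbT negbK.
Qed.

(** If [w] is not in [H :* g], then [g], [w] and [g * w] all define the same
    functional and lie in different cosets.  The functionals of [g * e], [w * e]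
    and [g * w * e] agree with one another on the kernel of [moves g], so that
    each is determined by a single bit; two of the three bits coincide, against
    [same_coset]. *)
Let same_kernel g w : g \in G -> w \in G -> ~~ T g -> ~~ T w ->
  {in H, moves w =1 moves g} -> w * g^-1 \in H.
Proof.
move=> gG wG nTg nTw eq; apply: contraT => wgH.
have gwG : g * w \in G by rewrite groupM.
have eqgw x : x \in H -> ~~ moves g x -> moves (g * w) x = false.
  by move=> xH gx; rewrite moves_fixl // eq // (negPf gx).
have nTgw : ~~ T (g * w).
  apply/norP; split.
    apply: contra wgH => gwH; have g2H : (g ^+ 2)^-1 \in H by rewrite groupV sqrH.
    have -> : w * g^-1 = (g * w) ^ g * (g ^+ 2)^-1.
      by rewrite /conjg expg2 invMg !mulgA mulVg mul1g mulgK.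
    by rewrite groupM // memJ_norm // (subsetP normH).
  rewrite mem_rcoset eK; apply/negP=> gweH; case: (moves_e_index gG nTg) => x xH ex.
  apply: contraTT ex => gx; rewrite -(moves_fixl e (g := g * w)) ?eqgw //.
  by apply/movesPn/cHH.
have {eqgw} eqgw : {in H, moves (g * w) =1 moves g}.
  by apply: kernel_moves => // x xH gx; rewrite eqgw.
have [g0 g0H] := notT nTg; have [z zH gz] := nontrivial_moves maxH wallG gG g0.
have agree a b : a \in G -> b \in G -> ~~ T a -> ~~ T b ->
    {in H, moves a =1 moves g} -> {in H, moves b =1 moves g} ->
    moves (a * e) z = moves (b * e) z -> a * b^-1 \in H.
  move=> aG bG nTa nTb ea eb eqz; have eab : {in H, moves a =1 moves b}.
    by move=> x xH; rewrite ea ?eb.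
  apply: same_coset => // x xH.
  have fixg y : y \in H -> ~~ moves g y -> moves (a * e) y = moves (b * e) y.
    by move=> yH gy; rewrite !moves_fixl ?ea ?eb.
  have [gx | ] := boolP (moves g x); last exact: fixg.
  have [aeG nTae] : a * e \in G /\ ~~ T (a * e) by rewrite groupM ?TN.
  have [beG nTbe] : b * e \in G /\ ~~ T (b * e) by rewrite groupM ?TN.
  have := fixg (x * z); rewrite (movesMT gG nTg) // gx gz groupM //.
  rewrite (movesMT aeG nTae) // (movesMT beG nTbe) // eqz => /(_ isT isT).
  exact: addIb.
have eqg : {in H, moves g =1 moves g} by [].
have nH : ~~ (w \in H) by case/norP: nTw.
have [e1 | ne1] := eqVneq (moves (w * e) z) (moves (g * e) z).
  by move: (agree w g wG gG nTw nTg eq eqg e1); rewrite (negPf wgH).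
have [e2' | ne2] := eqVneq (moves (g * w * e) z) (moves (g * e) z).
  move: (agree (g * w) g gwG gG nTgw nTg eqgw eqg e2').
  have -> : g * w * g^-1 = w ^ g^-1 by rewrite /conjg invgK mulgA.
  by rewrite memJ_norm ?groupV ?(subsetP normH) // (negPf nH).
have e3 : moves (g * w * e) z = moves (w * e) z.
  by move: ne1 ne2; do 3!case: (moves _ z).
move: (agree (g * w) w gwG wG nTgw nTw eqgw eq e3).
by rewrite mulgK (negPf g0).
Qed.

(** Let [h1] be moved by [g] and fixed by [g * e], and [h2] the other way round:
    modulo ['C_H[e]], which is central, they generate [H].  The functional of any
    further element [w], or else that of [w * e], vanishes at [h1] or [h2], so
    [same_kernel] puts [w] into one of the cosets of [H], [e], [g] and [g * e].
    Involutions [a] and [b] in the cosets of [g] and [g * e] can be adjusted to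
    commute. *)
Lemma exceptional_pairs g : g \in G -> ~~ T g -> commuting_pairs G.
Proof.
move=> gG nTg; have [geG nTge] : g * e \in G /\ ~~ T (g * e) by rewrite groupM ?TN.
have gee : g * e * e = g by rewrite -mulgA -expg2 e2 mulg1.
have [h2 h2H /andP[gh2 geh2]] := separate gG nTg.
have [h1 h1H] := separate geG nTge; rewrite gee => /andP[geh1 gh1].
have mg := movesMT gG nTg; have mge := movesMT geG nTge.
have [h1G h2G] := (subsetP sHG h1 h1H, subsetP sHG h2 h2H).
have fixU x : x \in H -> ~~ moves g x -> ~~ moves (g * e) x -> x \in 'C_H[e].
  by move=> xH gx gex; rewrite movesE // (moves_eE gG) // negb_or gx.
have UZ u : u \in 'C_H[e] -> u \in 'Z(G) by apply: exceptional_fix_central.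
pose k1 k := if moves g k then h1 else 1.
pose k2 k := if moves (g * e) k then h2 else 1.
have m1 x : moves x 1 = false by rewrite /moves comm1g eqxx.
have k1H k : k1 k \in H by rewrite /k1; case: ifP.
have k2H k : k2 k \in H by rewrite /k2; case: ifP.
have decU k : k \in H -> k * (k1 k * k2 k) \in 'C_H[e].
  move=> kH; apply: fixU; rewrite ?groupM // ?mg ?mge ?groupM // /k1 /k2.
    by case: (moves g k); case: (moves (g * e) k); rewrite ?m1 ?gh1 ?(negPf gh2).
  by case: (moves g k); case: (moves (g * e) k); rewrite ?m1 ?geh2 ?(negPf geh1).
have [k kH a2] := rcoset_meets_Ldiv2 maxH wallG gG; set a0 := k * g in a2.
have [l lH b2] := rcoset_meets_Ldiv2 maxH wallG geG; set b0 := l * (g * e) in b2.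
have [kG lG] := (subsetP sHG k kH, subsetP sHG l lH).
have [a0G b0G] : a0 \in G /\ b0 \in G by rewrite !groupM.
have [j jH j2] := rcoset_meets_Ldiv2 maxH wallG (groupM a0G b0G).
have ca0 x : x \in H -> ~~ moves g x -> commute x a0.
  by move=> xH gx; apply: commuteM; [apply: cHH | apply/movesPn].
have cb0 x : x \in H -> ~~ moves (g * e) x -> commute x b0.
  by move=> xH gx; apply: commuteM; [apply: cHH | apply/movesPn].
have ck2 : commute (k2 j) a0.
  by apply: ca0 => //; rewrite /k2; case: ifP => // _; rewrite m1.
have ck1 : commute (k1 j) b0.
  by apply: cb0 => //; rewrite /k1; case: ifP => // _; rewrite m1.
(* Since [j * a0 * b0] is an involution and [j] is [k1 j * k2 j] up to a central
   involution, so is [k1 j * k2 j * a0 * b0], which is conjugate to [a * b]. *)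
pose a := k2 j * a0; pose b := b0 * k1 j.
have [k1G k2G] := (subsetP sHG _ (k1H j), subsetP sHG _ (k2H j)).
have [aG bG] : a \in G /\ b \in G by rewrite !groupM.
have ca x : x \in H -> ~~ moves g x -> commute x a.
  by move=> xH gx; apply: commuteM; [apply: cHH | apply: ca0].
have cb x : x \in H -> ~~ moves (g * e) x -> commute x b.
  by move=> xH gx; apply: commuteM; [apply: cb0 | apply: cHH].
have cfix x y : commute x y -> x ^ y = x by move/commgP/conjg_fixP.
have conj_a : h1 ^ a = h1 ^ e.
  have ge1 : (h1 ^ g) ^ e = h1 by rewrite -conjgM; apply/cfix/movesPn.
  rewrite conjgM (cfix h1 (k2 j)) ?conjgM ?(cfix h1 k); try exact: cHH.
  by rewrite -[h1 ^ g](conjgK e) ge1 eK.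
have conj_b : h2 ^ b = h2 ^ e.
  have g2 : h2 ^ g = h2 by apply/cfix/movesPn.
  rewrite conjgM conjgM (cfix h2 l) ?conjgM ?g2; last exact: cHH.
  by apply/cfix/cHH; rewrite ?eNH.
have comm_a : [~ h1, a] = h1 * h1 ^ e by rewrite commgEl conj_a invg2 ?H2.
have comm_b : [~ h2, b] = h2 * h2 ^ e by rewrite commgEl conj_b invg2 ?H2.
have eh1 : moves e h1 by rewrite (moves_eE gG) // gh1.
have eh2 : moves e h2 by rewrite (moves_eE gG) // geh2 orbT.
have Pa : a ^+ 2 = 1 by rewrite /a expgMn // a2 H2 // mulg1.
have Pb : b ^+ 2 = 1 by rewrite /b expgMn ?b2 ?H2 ?mulg1 //; apply: commute_sym.
exists h1, a, h2, b; split.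
- by [].
- by split=> //; apply: H2.
- split; [exact: cHH | exact: cb | exact/commute_sym/ca | ].
  apply/(commute2 Pa Pb); pose u := j * (k1 j * k2 j).
  have uU : u \in 'C_H[e] by apply: decU.
  have u2 : u ^+ 2 = 1 by apply: H2; case/setIP: uU.
  have kk2 : (k1 j * k2 j) ^+ 2 = 1 by rewrite H2 ?groupM.
  have jE : j * (a0 * b0) = u * (k1 j * k2 j * (a0 * b0)).
    by rewrite /u -[RHS]mulgA [in RHS](mulgA (k1 j * k2 j)) -expg2 kk2 mul1g.
  have abE : a * b = (k1 j * k2 j * (a0 * b0)) ^ k1 j.
    by rewrite /conjg -(mulgA (k1 j) (k2 j)) -(mulgA (k1 j)) mulKg /a /b !mulgA.
  have ck : commute u (k1 j * k2 j * (a0 * b0)).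
    by have /setIP[_ /centP cu] := UZ u uU; apply: cu; rewrite !groupM.
  by move: j2; rewrite jE abE -conjXg expgMn // u2 mul1g => ->; rewrite conj1g.
- rewrite comm_a comm_b; split; rewrite ?UZ ?comm_e //.
  + by move: eh1; rewrite /moves commgEl invg2 ?H2.
  + by move: eh2; rewrite /moves commgEl invg2 ?H2.
  have h12H : h1 * h2 \in H by rewrite groupM.
  have : moves e (h1 * h2) by rewrite (moves_eE gG) // mg // gh1 (negPf gh2).
  apply: contra => /eqP eq12; apply/conjg_fixP.
  rewrite conjMg -[h1 ^ e](mulKg h1) eq12 -(mulgA h1^-1) -(mulgA h2) -expg2 -conjXg.
  by rewrite H2 // conj1g mulg1 invg2 ?H2.
set M := _ <*> _; have sDM : <<[set h1; a]>> \subset M.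
  exact: subset_trans (joing_subr _ _) (joing_subl _ _).
have [ZM h1M aM h2M bM] : [/\ 'Z(G) \subset M, h1 \in M, a \in M, h2 \in M & b \in M].
  split; first exact: subset_trans (joing_subl _ _) (joing_subl _ _).
  - by rewrite (subsetP sDM) ?mem_gen ?set21.
  - by rewrite (subsetP sDM) ?mem_gen ?set22.
  - by rewrite (subsetP (joing_subr _ _)) ?mem_gen ?set21.
  by rewrite (subsetP (joing_subr _ _)) ?mem_gen ?set22.
have k1M i : k1 i \in M by rewrite /k1; case: ifP.
have k2M i : k2 i \in M by rewrite /k2; case: ifP.
have HM : H \subset M.
  apply/subsetP=> x xH; rewrite -(mulgK (k1 x * k2 x) x).
  by apply: groupM; [rewrite (subsetP ZM) // UZ ?decU | rewrite groupV groupM].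
have gM : g \in M.
  have a0M : a0 \in M by rewrite -(mulKg (k2 j) a0) groupM ?groupV.
  by rewrite -(mulKg k g) groupM ?groupV ?(subsetP HM k).
have geM : g * e \in M.
  have b0M : b0 \in M by rewrite -(mulgK (k1 j) b0) groupM ?groupV.
  by rewrite -(mulKg l (g * e)) groupM ?groupV ?(subsetP HM l).
have eM : e \in M by rewrite -(mulKg g e) groupM ?groupV.
have same g' w : g' \in M -> w * g'^-1 \in H -> w \in M.
  by move=> g'M wgH; rewrite -(mulgKV g' w) groupM // (subsetP HM).
have mulhE x y : x \in H -> y \in H ->
    ~~ moves g (x * y) -> ~~ moves (g * e) (x * y) ->
  forall w, w \in G -> ~~ T w -> moves w x = moves w y.
- move=> xH yH gxy gexy w wG nTw; have xyH : x * y \in H by rewrite groupM.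
  apply: addIb (moves w y) _ _ _; rewrite addbb -(movesMT wG nTw) //.
  by apply/negbTE/(fix_e_fix wG nTw); rewrite // -movesE // fixU.
have case1 w : w \in G -> ~~ T w -> ~~ moves w h1 -> w \in M.
  move=> wG nTw wh1; apply: (same (g * e)) => //; apply: same_kernel => //.
  apply: kernel_moves => // x xH gex; have [gx | gx] := boolP (moves g x).
    by rewrite (mulhE x h1) ?mg ?mge ?gx ?gh1 ?(negPf geh1) ?(negPf gex).
  by apply: (fix_e_fix wG nTw) => //; rewrite -movesE // fixU.
have case2 w : w \in G -> ~~ T w -> ~~ moves w h2 -> w \in M.
  move=> wG nTw wh2; apply: (same g) => //; apply: same_kernel => //.
  apply: kernel_moves => // x xH gx; have [gex | gex] := boolP (moves (g * e) x).
    by rewrite (mulhE x h2) ?mg ?mge ?gex ?geh2 ?(negPf gh2) ?(negPf gx).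
  by apply: (fix_e_fix wG nTw) => //; rewrite -movesE // fixU.
apply/subsetP=> w wG; have [/orP[/(subsetP HM) // | ] | nTw] := boolP (T w).
  by rewrite mem_rcoset => /same; apply.
have [wh1 | ] := boolP (moves w h1); last exact: case1.
have [wh2 | ] := boolP (moves w h2); last exact: case2.
have [weG nTwe] : w * e \in G /\ ~~ T (w * e) by rewrite groupM ?TN.
suff weM : w * e \in M by rewrite -(mulgK e w) groupM ?groupV.
have : moves (w * e) (h1 * h2).
  rewrite moves_fixl ?(movesMT wG nTw) ?wh1 ?wh2 //.
  by rewrite (moves_eE gG) ?groupM // mg // gh1 (negPf gh2).
rewrite (movesMT weG nTwe) //.
case weh1: (moves (w * e) h1) => weh2; last by apply: case1; rewrite ?weh1.
by apply: case2; rewrite // -[moves _ _]negbK -addTb.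
Qed.

Lemma exceptional_coset : abelem_index2 G \/ commuting_pairs G.
Proof.
have [/forall_inP GT | ] := boolP [forall x in G, T x].
  by left; apply: exceptional_index2.
by rewrite negb_forall_in => /exists_inP[g gG nTg]; right; apply: exceptional_pairs nTg.
Qed.

End ExceptionalCoset.

(** * Groups consisting mostly of involutions *)


(** Wall's classification.  Let [H] be a maximal elementary abelian subgroup: it is
    [G], or there is an exceptional coset, or all the hyperplanes ['C_H[g]] for
    [g] outside [H] coincide, or two of them differ. *)
Theorem mostly_involutions (gT : finGroupType) (G : {group gT}) :
    #|G| < 2 * #|'Ldiv_2(G)| ->
  [\/ 2.-abelem G, inverted_index2 G, commuting_pairs G |
      abelem_index2 G \/ exists2 z, z \in 'Z(G) & z ^+ 2 = 1 /\
        {in G, forall x, x ^+ 2 = 1 \/ x ^+ 2 = z}].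
Proof.
move=> wallG; have E1 : 1%G \in 'E_2(G) by rewrite inE sub1G abelem1.
have [H maxH _] := pmaxElem_exists E1; have sHG := maxE_sub maxH.
have [eqHG | ltHG] := eqVproper sHG.
  by have /pmaxElemP[/pElemP[_ abH] _] := maxH; constructor 1; rewrite -eqHG.
have [/exists_inP[g0 g0G ig0] | ] := boolP [exists g in G, 2 < #|H : 'C_H[g]|].
  have [h hH e2] := rcoset_meets_Ldiv2 maxH wallG g0G.
  have eG : h * g0 \in G by rewrite groupM // (subsetP sHG).
  rewrite -(rcoset_cent1 maxH g0 hH) in ig0.
  case: (exceptional_coset maxH wallG eG e2 ig0); last by constructor 3.
  by constructor 4; left.
move/exists_inPn=> iH2; have {}iH2 : {in G, forall g, #|H : 'C_H[g]| <= 2}.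
  by move=> g gG; rewrite leqNgt iH2.
have /subsetPn[a aG aH] := proper_subn ltHG.
have [eqK | neqK] := boolP [forall b in G, (b \notin H) ==> ('C_H[b] == 'C_H[a])].
  have iHK : #|H : 'C_H[a]| = 2.
    by apply/eqP; rewrite eqn_leq iH2 // (maxE_index_gt1 maxH).
  have cHK : {in G, forall g, g \notin H -> 'C_H[g] = 'C_H[a]}.
    by move=> g gG gH; apply/eqP; apply: (implyP (forall_inP eqK g gG)).
  case: (common_hyperplane maxH wallG ltHG iHK cHK); first by constructor 2.
  by constructor 4; left.
move: neqK; rewrite negb_forall_in => /exists_inP[b bG]; rewrite negb_imply => /andP[bH nK].
constructor 4; right.
exact: (transvections_sqr_central maxH wallG iH2 bG aG bH aH nK).
Qed.

(** * Counting cyclic subgroups by elements *)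

Import Order.TTheory GRing.Theory Num.Theory.


Lemma totient_size n : totient n = size [seq d <- iota 0 n | coprime n d].
Proof.
rewrite size_filter -sum1_count big_mkcond totient_count_coprime /index_iota subn0.
by apply: eq_bigr => d _; case: coprime.
Qed.

(** A unit [d] modulo [n] with [1 < d < n.-1] produces the four units
    [1], [d], [n - d] and [n - 1]. *)
Lemma totient_ge4 n : 0 < n -> ~~ (n %| 4) -> ~~ (n %| 6) -> 4 <= totient n.
Proof.
move=> n0 n4 n6; have [d [d1 dn cnd]] : exists d, [/\ 1 < d, d < n.-1 & coprime n d].
  have n7 : (n == 5) || (6 < n) by move: n n0 n4 n6; do 7!case=> //.
  have [oddn | evenn] := boolP (odd n).
    exists 2; rewrite coprimen2 oddn; split=> //.
    by case/orP: n7 => [/eqP-> // | ]; lia.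
  have n8 : 7 < n.
    case/orP: n7 => [/eqP eqn | n7]; first by rewrite eqn in evenn.
    by rewrite ltn_neqAle n7 andbT; apply: contraNneq evenn => <-.
  have [k defn] : exists k, n = k.*2.
    by exists n./2; rewrite -[LHS]odd_double_half (negPf evenn).
  (* The unit is half of [n] minus 1 or 2, whichever is odd. *)
  have [oddk | evenk] := boolP (odd k).
    exists (k - 2); split; try lia.
    have -> : n = (k - 2) * 2 + 4 by lia.
    rewrite coprime_sym /coprime mulnC gcdnMDl -/(coprime _ _) (coprimeXr 2 (n := 2)) //.
    by rewrite coprimen2 oddB //; lia.
  exists k.-1; split; try lia.
  have -> : n = 2 * k.-1 + 2 by lia.
  by rewrite coprime_sym /coprime gcdnMDl -/(coprime _ _) coprimen2; lia.
rewrite totient_size; pose s := [:: 1%N; d; n - d; n.-1].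
have d2 : d != n - d.
  apply: contraTneq cnd => eqd; have -> : n = (2 * d)%N by lia.
  by rewrite /coprime mulnC gcdnC gcdnMr neq_ltn d1 orbT.
have us : uniq s by rewrite /= !inE; lia.
rewrite -[4]/(size s); apply: uniq_leq_size => // x.
have memf y : 0 < y < n -> coprime n y -> y \in [seq d <- iota 0 n | coprime n d].
  by move=> ? cny; rewrite mem_filter cny mem_iota; lia.
have cnB y : y <= n -> coprime n y -> coprime n (n - y).
  move=> ley; rewrite /coprime gcdnC (gcdnC n (n - y)) => /eqP <-.
  have -> : gcdn (n - y) n = gcdn (n - y) y by rewrite -{2}(subnK ley) gcdnDl.
  by rewrite gcdnC -{2}(subnK ley) gcdnDr.
rewrite !inE => /or4P[] /eqP ->; apply: memf; rewrite ?coprimen1 //; try lia.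
  by apply: cnB => //; lia.
by rewrite -subn1 cnB ?coprimen1.
Qed.

Section Weight.

Variable gT : finGroupType.
Implicit Types (G : {group gT}) (x y : gT).

(** The sum of these weights over the generators of a cyclic group is 1, so they
    count cyclic subgroups. *)
Definition weight x : rat := ((totient #[x])%:R^-1)%R.

Lemma ncyclic_weight G : ((ncyclic G)%:R = \sum_(x in G) weight x)%R.
Proof.
pose S := [set C in subgroups G | cyclic C].
rewrite (partition_big (fun x => <[x]>%G) [in S]) => [|x xG] /=; last first.
  by rewrite !inE cycle_subG xG cycle_cyclic.
rewrite /ncyclic -sum1_card natr_sum; apply: eq_bigr => C.
rewrite !inE => /andP[sCG /cyclicP[y defC]].
have yG : y \in G by rewrite -cycle_subG -defC.
rewrite (eq_bigr (fun _ => weight y)) => [|x /andP[_ /eqP eqC]]; last first.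
  by rewrite /weight /order -defC -eqC.
rewrite sumr_const (_ : #|_| = totient #[y]).
  by rewrite /weight -[RHS]mulr_natr mulVf // pnatr_eq0 -lt0n totient_gt0 order_gt0.
rewrite totient_gen; apply: eq_card => x; rewrite inE /generator -defC.
rewrite unfold_in -val_eqE /= [RHS]eq_sym andb_idl // => /eqP defx.
by rewrite -cycle_subG defx.
Qed.

Lemma weight1 x : x ^+ 2 = 1 -> weight x = 1%R.
Proof.
move=> x2; have : #[x] %| 2 by rewrite order_dvdn x2.
by rewrite /weight; case: #[x] (order_gt0 x) => [|[|[|n]]].
Qed.

Lemma weight_le2 x : x ^+ 2 != 1 -> (weight x <= 2^-1)%R.
Proof.
rewrite -order_dvdn => nx2; rewrite lef_pV2 ?posrE ?ltr0n ?totient_gt0 ?order_gt0 //.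
rewrite (ler_nat _ 2) totient_gt1.
by case: #[x] (order_gt0 x) nx2 => [|[|[|n]]].
Qed.

Lemma weight_half x : x ^+ 2 != 1 -> (x ^+ 4 == 1) || (x ^+ 6 == 1) ->
  weight x = (2^-1)%R.
Proof.
rewrite -!order_dvdn /weight; have := order_gt0 x; move: #[x] => n n0 n2 n46.
have n7 : n < 7 by case/orP: n46 => /dvdn_leq; lia.
by move: n n0 n2 n46 n7; do 7!case=> //.
Qed.

Lemma weight_le4 x : x ^+ 4 != 1 -> x ^+ 6 != 1 -> (weight x <= 4^-1)%R.
Proof.
rewrite -!order_dvdn => nx4 nx6.
rewrite lef_pV2 ?posrE ?ltr0n ?totient_gt0 ?order_gt0 //.
by rewrite (ler_nat _ 4) totient_ge4 ?order_gt0.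
Qed.

Lemma setD_Ldiv2 G x : x \in G :\: 'Ldiv_2() -> x \in G /\ x ^+ 2 != 1.
Proof. by rewrite !inE => /andP[]. Qed.

Lemma sum_weight_half G : {in G, forall x, (x ^+ 4 == 1) || (x ^+ 6 == 1)} ->
  (\sum_(x in G) weight x = (#|G|%:R + #|'Ldiv_2(G)|%:R) / 2)%R.
Proof.
move=> G46; rewrite (big_setID 'Ldiv_2()) /= -(cardsID 'Ldiv_2() G).
rewrite (eq_bigr (fun=> 1%R)) => [|x /LdivP[_ /weight1] //].
rewrite [X in (_ + X)%R](eq_bigr (fun=> 2^-1)%R) => [|x /setD_Ldiv2[xG x2]]; last first.
  exact: weight_half (G46 x xG).
rewrite !sumr_const natrD -(mulr_natl (2^-1)%R); lra.
Qed.

Lemma sum_weight_le G :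
  (\sum_(x in G) weight x <= (#|G|%:R + #|'Ldiv_2(G)|%:R) / 2)%R.
Proof.
rewrite (big_setID 'Ldiv_2()) /= -(cardsID 'Ldiv_2() G).
rewrite (eq_bigr (fun=> 1%R)) => [|x /LdivP[_ /weight1] //].
have : (\sum_(x in G :\: 'Ldiv_2()) weight x <= \sum_(x in G :\: 'Ldiv_2()) 2^-1)%R.
  by apply: ler_sum => x /setD_Ldiv2[_ /weight_le2].
rewrite !sumr_const natrD -(mulr_natl (2^-1)%R); lra.
Qed.

Lemma alpha_weight G : alpha G = ((\sum_(x in G) weight x) / #|G|%:R)%R.
Proof. by rewrite /alpha ncyclic_weight. Qed.

Lemma alpha_gt_involutions G : (3%:R / 4%:R < alpha G)%R -> #|G| < 2 * #|'Ldiv_2(G)|.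
Proof.
have G0 : (0 < #|G|%:R :> rat)%R by rewrite ltr0n.
rewrite alpha_weight ltr_pdivlMr // => lt34; have := sum_weight_le G => le2.
by rewrite -(ltr_nat rat) natrM; lra.
Qed.

Lemma alpha_half G : {in G, forall x, (x ^+ 4 == 1) || (x ^+ 6 == 1)} ->
  alpha G = ((#|G|%:R + #|'Ldiv_2(G)|%:R) / (2 * #|G|%:R))%R.
Proof.
move=> G46; rewrite alpha_weight sum_weight_half //; field.
by rewrite pnatr_eq0 -lt0n cardG_gt0.
Qed.

(** A form of [alpha_half] without divisions. *)
Lemma alpha_eq_val G q : {in G, forall x, (x ^+ 4 == 1) || (x ^+ 6 == 1)} ->
    0 < q -> (2 * q * (#|G| + #|'Ldiv_2(G)|) = (3 * q + 1) * #|G|)%N ->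
  alpha G = alpha_val q.
Proof.
move=> G46 q0 eqn; rewrite alpha_half // /alpha_val.
have : (2%:R * q%:R * (#|G|%:R + #|'Ldiv_2(G)|%:R) = (3%:R * q%:R + 1) * #|G|%:R :> rat)%R.
  by rewrite -natrD -!natrM eqn natrM natrD natrM.
have : (#|G|%:R != 0 :> rat)%R by rewrite pnatr_eq0 -lt0n cardG_gt0.
have : (q%:R != 0 :> rat)%R by rewrite pnatr_eq0 -lt0n.
move: (q%:R)%R (#|G|%:R)%R (#|'Ldiv_2(G)|%:R)%R => x y j x0 y0 eq.
apply/eqP; rewrite eqr_div ?mulf_neq0 // -subr_eq0.
have -> : ((y + j) * (4 * x) - (3 * x + 1) * (2 * y)
          = 2 * (2 * x * (y + j) - (3 * x + 1) * y))%R by ring.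
by rewrite eq subrr mulr0.
Qed.

Lemma order_dprod_lcm x y : commute x y -> <[x]> :&: <[y]> = 1 ->
  #[x * y] = lcmn #[x] #[y].
Proof.
move=> cxy tixy; apply/eqP; rewrite eqn_dvd order_dvdn expgMn //.
rewrite dvdn_lcm.
have -> : x ^+ lcmn #[x] #[y] = 1 by apply/eqP; rewrite -order_dvdn dvdn_lcml.
have -> : y ^+ lcmn #[x] #[y] = 1 by apply/eqP; rewrite -order_dvdn dvdn_lcmr.
rewrite mulg1 eqxx /=; have : (x * y) ^+ #[x * y] == 1 by rewrite -order_dvdn.
move: #[x * y] => n; rewrite expgMn // -eq_invg_mul => /eqP xy.
have : (x ^+ n)^-1 \in <[x]> :&: <[y]> by rewrite inE groupV mem_cycle xy mem_cycle.
by rewrite tixy xy !order_dvdn => /set1P yn; rewrite yn -[x ^+ n]invgK xy yn invg1 eqxx.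
Qed.

(** The order of [x * y] is that of [y], or twice that of [y] with the latter odd;
    in both cases the totient is the same. *)
Lemma weight_dprod (E : {group gT}) G x y :
    2.-abelem E -> E :&: G = 1 -> G \subset 'C(E) -> x \in E -> y \in G ->
  weight (x * y) = weight y.
Proof.
move=> /abelemP-/(_ isT)[_ E2] tiEG cEG xE yG; rewrite /weight order_dprod_lcm.
- have : #[x] %| 2 by rewrite order_dvdn E2.
  have /= := order_gt0 x; case: #[x] => [|[|[|n]]] // _ _; first by rewrite lcm1n.
  congr ((_ %:R)^-1)%R; have [o2 | o2] := boolP (2 %| #[y]).
    by congr totient; apply/lcmn_idPr.
  have co : coprime 2 #[y] by rewrite prime_coprime.
  by rewrite -[lcmn 2 _]muln1 -{2}(eqP co) muln_lcm_gcd totient_coprime // mul1n.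
- exact/commute_sym/(centsP cEG).
by apply/trivgP; rewrite -tiEG setISS ?cycle_subG.
Qed.

Lemma mulg_TI_inj (E G : {group gT}) : E :&: G = 1 ->
  {in setX E G &, injective (fun p => p.1 * p.2)}.
Proof.
move=> tiEG [e g] [e' g'] /setXP[/= eE gG] /setXP[/= e'E g'G] eq.
have eq' : e'^-1 * e = g' * g^-1.
  by apply: (mulgI e'); rewrite mulKVg mulgA -eq mulgK.
have : e'^-1 * e \in E :&: G by rewrite inE {2}eq' !groupM ?groupV.
rewrite tiEG => /set1P e1; have ee : e = e'.
  by apply/eqP; rewrite eq_sym eq_mulVg1 e1.
by congr (_, _) => //; apply: (mulgI e); rewrite {2}ee.
Qed.

Lemma card_Ldiv_dprod (E G X : {group gT}) n : E \x G = X ->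
  #|'Ldiv_n(X)| = (#|'Ldiv_n(E)| * #|'Ldiv_n(G)|)%N.
Proof.
case/dprodP=> _ defX cEG tiEG; rewrite -cardsX.
rewrite -(card_in_imset (sub_in2 _ (mulg_TI_inj tiEG))) => [|[e g]]; last first.
  by case/setXP=> /LdivP[eE _] /LdivP[gG _]; apply/setXP.
congr #|pred_of_set _|; apply/setP=> x; apply/LdivP/imsetP=> [[xX xn] | [[e g]]].
  move: xX; rewrite -defX => /mulsgP[e g eE gG defx]; exists (e, g) => //.
  have ceg : commute e g by apply/commute_sym/(centsP cEG).
  move: xn; rewrite defx expgMn // => /eqP; rewrite -eq_invg_mul => /eqP en.
  have : (e ^+ n)^-1 \in E :&: G by rewrite inE {2}en !groupV !groupX.
  rewrite tiEG => /set1P eV; have en1 : e ^+ n = 1 by rewrite -[LHS]invgK eV invg1.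
  by apply/setXP; split; apply/LdivP; rewrite ?en1 -?en ?eV.
case/setXP=> /LdivP[/= eE en] /LdivP[/= gG gn] ->.
rewrite -defX mem_mulg // expgMn ?en ?gn ?mulg1 //.
exact/commute_sym/(centsP cEG).
Qed.

Lemma alpha_dprod (E G X : {group gT}) : E \x G = X -> 2.-abelem E -> alpha X = alpha G.
Proof.
move=> /dprodP[_ defX cEG tiEG] abE; rewrite !alpha_weight.
have cardX : #|X| = (#|E| * #|G|)%N by rewrite -defX TI_cardMg.
have defX' : X = [set p.1 * p.2 | p in setX E G] :> {set gT}.
  rewrite -defX; apply/setP=> x; apply/mulsgP/imsetP=> [[e g eE gG ->] | [[e g] /setXP[eE gG] ->]].
    by exists (e, g); rewrite // inE eE.
  by exists e g.
have -> : (\sum_(x in X) weight x = #|E|%:R * \sum_(x in G) weight x)%R.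
  rewrite (eq_bigl (mem [set p.1 * p.2 | p in setX E G])) => [|x]; last by rewrite defX'.
  rewrite big_imset /=.
    rewrite (eq_bigl (fun p => (p.1 \in E) && (p.2 \in G))) => [|p]; last by rewrite inE.
    rewrite -(pair_big [in E] [in G] (fun e g => weight (e * g))) /=.
    rewrite mulr_natl -sumr_const; apply: eq_bigr => e eE; apply: eq_bigr => g gG.
    exact: weight_dprod cEG eE gG.
  exact: mulg_TI_inj.
rewrite cardX natrM; field.
by rewrite !pnatr_eq0 -!lt0n !cardG_gt0.
Qed.
End Weight.

(** * Direct factors of order two *)


Section C2Factor.

Variable gT : finGroupType.
Implicit Types (G K C E X M : {group gT}) (w x e : gT).

Lemma dprod_C2_factor G C K : #|C| = 2 -> C \x K = G -> has_C2_factor G.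
Proof.
move=> oC defG; exists C, K; split=> //.
have oZ : #|[set: 'Z_2]| = 2 by rewrite cardsT card_ord.
have cC : cyclic C by rewrite prime_cyclic ?oC.
by rewrite isog_cyclic_card // oC oZ prime_cyclic ?oZ.
Qed.

(** A maximal subgroup not containing [w] is a direct complement of [<[w]>]. *)
Lemma central_C2_factor G w : w \in 'Z(G) -> w ^+ 2 = 1 -> w \notin 'Phi(G) ->
  has_C2_factor G.
Proof.
move=> wZ w2 wPhi; have [wG cGw] := setIP wZ.
have w1 : w != 1 by apply: contraNneq wPhi => ->; apply: group1.
have ow : #[w] = 2 by apply: nt_prime_order.
have [M maxM wM] : exists2 M : {group gT}, maximal M G & w \notin M.
  apply/exists_inP; apply: contraR wPhi => /exists_inPn wPhi.
  apply/bigcapP=> M /predU1P[-> // | /wPhi]; exact: negbNE.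
have sMG := maxgroupp maxM; have [ltMG maxMG] := maxgroupP maxM.
have tiwM : <[w]> :&: M = 1 by rewrite prime_TIg -?orderE ?ow // cycle_subG.
have cwM : M \subset 'C(<[w]>).
  by rewrite cent_cycle sub_cent1 (subsetP (centS (proper_sub ltMG))).
apply: (@dprod_C2_factor G <[w]>%G M); first by rewrite -orderE.
rewrite dprodE //; apply/eqP; rewrite eqEsubset mul_subG ?cycle_subG ?(proper_sub ltMG) //=.
have sJG : <[w]> <*> M \subset G by rewrite join_subG cycle_subG wG (proper_sub ltMG).
case: (eqVproper sJG) => [eqJ | ltwM]; first by rewrite -eqJ cent_joinEr.
have defM := maxMG (<[w]> <*> M)%G ltwM (joing_subr _ _).
by case/negP: wM; rewrite -defM (subsetP (joing_subl _ _)) ?cycle_id.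
Qed.

Lemma abelem2_trivial G : 2.-abelem G -> ~ has_C2_factor G -> G :=: 1.
Proof.
move=> abG nC2; apply/trivgP/subsetP=> w wG; apply/set1P/eqP/idPn=> w1.
have [_ G2] := abelemP (isT : prime 2) abG.
have [|K defG] := abelem_split_dprod abG (_ : <[w]> \subset G).
  by rewrite cycle_subG.
apply: nC2; apply: dprod_C2_factor defG; rewrite -orderE.
by apply: nt_prime_order => //; apply: G2.
Qed.

Lemma split_C2_factors X : exists E G, [/\ E \x G = X, 2.-abelem E & ~ has_C2_factor G].
Proof.
have [n] := ubnP #|X|; elim: n X => // n IHn X leX.
pose hasC2 := [exists C : {group gT}, exists K : {group gT},
                (C \isog [set: 'Z_2]) && (C \x K == X)].
have [/existsP[C /existsP[K /andP[isoC /eqP defX]]] | noC2] := boolP hasC2; last first.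
  exists 1%G, X; split; rewrite ?abelem1 ?dprod1g // => -[C [K [isoC defX]]].
  case/negP: noC2; apply/existsP; exists C; apply/existsP; exists K.
  by rewrite isoC defX eqxx.
have oC : #|C| = 2 by rewrite (card_isog isoC) cardsT card_ord.
have ltKX : #|K| < n.
  by apply: leq_trans (_ : #|X| <= n) => //; rewrite -(dprod_card defX) oC ltn_Pmull.
have [E [G [defK abE nC2]]] := IHn K ltKX.
have [cCE tiCE] : E \subset 'C(C) /\ C :&: E = 1.
  have [_ _ cCK tiCK] := dprodP defX; have [_ defK' _ _] := dprodP defK.
  have sEK : E \subset K by rewrite -defK' mulG_subl.
  by split; [exact: subset_trans cCK | apply/trivgP; rewrite -tiCK setIS].
exists (C <*> E)%G, G; split=> //.
  by rewrite /= cent_joinEr // -(dprodE cCE tiCE) -dprodA defK.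
rewrite (dprod_abelem 2 (_ : C \x E = C <*> E)) ?dprodE ?cent_joinEr // abE andbT.
apply: exponent2_abelem; rewrite -oC; exact: exponent_dvdn.
Qed.

Lemma quotient_abelem2 G M : M <| G -> {in G, forall x, x ^+ 2 \in M} ->
  2.-abelem (G / M).
Proof.
move=> nMG G2; apply: exponent2_abelem; apply/exponentP=> _ /morphimP[x xN xG ->].
by rewrite -morphX //; apply: coset_id; apply: G2.
Qed.

(** The quotient [G / M] being elementary abelian, [M] contains the Frattini
    subgroup, outside of which a central involution would split off. *)
Lemma central_involution_sqr G M w : 2.-group G -> ~ has_C2_factor G -> M <| G ->
  {in G, forall x, x ^+ 2 \in M} -> w \in 'Z(G) -> w ^+ 2 = 1 -> w \in M.
Proof.
move=> pG nC2 nMG G2 wZ w2.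
have sPhiM := Phi_min pG (normal_norm nMG) (quotient_abelem2 nMG G2).
by apply: (subsetP sPhiM); apply/idPn => /(central_C2_factor wZ w2).
Qed.

End C2Factor.

(** * Counting in extensions by inversion *)


Section Inverted.

Variables (gT : finGroupType) (G A : {group gT}) (e : gT).
Hypotheses (defG : A ><| <[e]> = G) (oe : #[e] = 2).
Hypothesis inv : {in A, forall a, a ^ e = a^-1}.
Implicit Types (x y w : gT).

Lemma inverted_outside x : x \in G -> x \notin A -> x ^+ 2 = 1.
Proof.
have e2 : e ^+ 2 = 1 by rewrite -oe expg_order.
move=> xG xA; have := inv (sdprod2_coset defG oe xG xA).
rewrite /conjg (invg2 e2) invMg (invg2 e2) => /mulgI; rewrite -mulgA -expg2 e2 mulg1.
by move=> xV; rewrite expg2 {1}xV mulVg.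
Qed.

Lemma inverted_Ldiv2 : #|'Ldiv_2(G)| = (#|'Ldiv_2(A)| + #|A|)%N.
Proof.
rewrite -(cardsID A); congr (_ + _)%N.
  by rewrite setIAC (setIidPr (sdprod2_sub defG)).
have -> : 'Ldiv_2(G) :\: A = G :\: A.
  apply/setP=> x; rewrite !inE; case xA: (x \in A) => //=.
  by case xG: (x \in G); rewrite //= inverted_outside ?xA ?eqxx.
rewrite cardsD (setIidPr (sdprod2_sub defG)) (sdprod2_card defG oe); lia.
Qed.

Lemma inverted_sum_weight :
  (\sum_(x in G) weight x = \sum_(x in A) weight x + #|A|%:R)%R.
Proof.
rewrite (big_setID A) /= (setIidPr (sdprod2_sub defG)); congr (_ + _)%R.
rewrite (eq_bigr (fun=> 1%R)) => [|x /setDP[xG xA]]; last first.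
  by rewrite weight1 ?inverted_outside.
rewrite sumr_const cardsD (setIidPr (sdprod2_sub defG)) (sdprod2_card defG oe).
by rewrite mul2n -addnn addnK.
Qed.

(** Inversion fixes the elements of [C] and normalises [K], so the complement
    [K] extends to [K <*> <[e]>]. *)
Lemma inverted_C2_factor (C K : {group gT}) : #|C| = 2 -> C \x K = A -> has_C2_factor G.
Proof.
move=> oC defA; have [_ defA' cCK tiCK] := dprodP defA.
have [sCA sKA] : C \subset A /\ K \subset A by rewrite -defA' mulG_subl mulG_subr.
have [_ defG' _ tiAe] := sdprodP defG.
have nKe : <[e]> \subset 'N(K).
  rewrite cycle_subG inE; apply/subsetP=> _ /imsetP[k kK ->].
  by rewrite inv ?groupV // (subsetP sKA).
have e2 : e ^+ 2 = 1 by rewrite -oe expg_order.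
apply: (@dprod_C2_factor _ G C (K <*> <[e]>)%G) => //.
have KeE := norm_joinEr nKe; rewrite dprodE /= ?KeE ?mulgA ?defA' //.
  rewrite mul_subG // cycle_subG; apply/centP=> c cC; apply/commute_sym.
  have c2 : c ^+ 2 = 1 by rewrite -oC expg_cardG.
  by apply/commgP/conjg_fixP; rewrite inv ?invg2 // (subsetP sCA).
rewrite -KeE; apply/trivgP/subsetP=> x; rewrite /= KeE.
case/setIP=> xC /mulsgP[k y kK ye defx].
have yA : y \in A.
  by rewrite -(mulKg k y) -defx groupM ?groupV ?(subsetP sKA k) ?(subsetP sCA x).
have : y \in A :&: <[e]> by rewrite inE yA.
rewrite tiAe => /set1P y1; rewrite -tiCK inE xC.
by rewrite defx y1 mulg1.
Qed.

End Inverted.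

(** * Maps out of a direct power *)


Lemma prodgM_commute (gT : finGroupType) (I : eqType) (s : seq I) (f g : I -> gT) :
    uniq s -> (forall i j, i != j -> commute (f i) (g j)) ->
  \prod_(i <- s) (f i * g i) = (\prod_(i <- s) f i) * (\prod_(i <- s) g i).
Proof.
move=> us cfg; elim: s us => [|i s IHs] /=; first by rewrite !big_nil mulg1.
case/andP=> is_s /IHs; rewrite !big_cons => ->.
rewrite -!mulgA; congr (_ * _); rewrite !mulgA; congr (_ * _).
apply: commute_sym; rewrite big_seq; elim/big_rec: _ => [|j y js cy].
  exact: commute_sym (commute1 _).
apply/commute_sym/commuteM; last exact: commute_sym.
by apply/commute_sym/cfg; apply: contraNneq is_s => <-.
Qed.

Section PowerMorphism.

Variables (gT T : finGroupType) (n : nat) (phi : 'I_n -> T -> gT).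
Hypothesis phiM : forall i, {morph phi i : x y / x * y}.
Hypothesis cphi : forall i j x y, i != j -> commute (phi i x) (phi j y).

Let prod_phi (a : gpow T n) := \prod_(i < n) phi i (a i).

Let prod_phiM : {in [set: gpow T n] &, {morph prod_phi : a b / a * b}}.
Proof.
move=> a b _ _; rewrite /prod_phi -prodgM_commute ?index_enum_uniq //.
  by apply: eq_bigr => i _; rewrite ffunE phiM.
by move=> i j ij; apply: cphi.
Qed.

Let phi1 i : phi i 1 = 1.
Proof. by apply: (mulgI (phi i 1)); rewrite -phiM !mulg1. Qed.

Definition gpow_single (i : 'I_n) (x : T) : gpow T n :=
  [ffun j => if j == i then x else 1].

Lemma prod_gpow_single i x : \prod_(j < n) phi j (gpow_single i x j) = phi i x.
Proof.
rewrite (eq_bigr (fun j => if j == i then phi i x else 1)) => [|j _].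
  by rewrite -big_mkcond big_pred1_eq.
by rewrite ffunE; case: eqP => [->|_].
Qed.

(** With cycles for the images of [phi] this yields direct products of cycles,
    with dihedral groups it yields their central products. *)
Lemma gpow_morphism (G : {group gT}) :
    (forall i x, phi i x \in G) ->
    (forall M : {group gT}, (forall i x, phi i x \in M) -> G \subset M) ->
  exists F : {morphism [set: gpow T n] >-> gT},
    (forall a, F a = \prod_(i < n) phi i (a i)) /\ F @* [set: gpow T n] = G.
Proof.
move=> phiG genG; exists (Morphism prod_phiM); split=> //.
apply/eqP; rewrite eqEsubset; apply/andP; split.
  by apply/subsetP=> _ /morphimP[a _ _ ->]; apply: group_prod => i _; apply: phiG.
apply: genG => i x; apply/morphimP; exists (gpow_single i x); rewrite ?inE //=.
by rewrite /prod_phi prod_gpow_single.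
Qed.

Lemma gpow_isog (G : {group gT}) :
    (forall i x, phi i x \in G) ->
    (forall M : {group gT}, (forall i x, phi i x \in M) -> G \subset M) ->
  #|G| = (#|T| ^ n)%N -> G \isog [set: gpow T n].
Proof.
move=> phiG genG oG; have [F [_ defG]] := gpow_morphism phiG genG.
rewrite isog_sym; apply/isogP; exists F => //; rewrite -card_im_injm defG oG.
by rewrite cardsT card_dep_ffun foldrE big_map big_enum prod_nat_const card_ord.
Qed.

End PowerMorphism.

Lemma homocyclic_generators (gT : finGroupType) (A : {group gT}) : homocyclic A ->
  exists x : 'I_('r(A)) -> gT, (forall i, x i \in A) /\
    forall M : {group gT}, (forall i, x i \in M) -> A \subset M.
Proof.
move=> homA; have [cAA _] := andP homA; have [b defA ob] := abelian_structure cAA.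
rewrite (abelian_type_homocyclic homA) in ob.
have sb : size b = 'r(A) by rewrite -(size_map order) ob size_nseq.
have genb := bigdprodWY defA; rewrite bigcup_seq in genb.
exists (fun i : 'I_('r(A)) => b`_i); split=> [i | M xM].
  have ib : b`_i \in b by rewrite mem_nth ?sb.
  have /(subset_trans (bigcup_sup _ ib)) : \bigcup_(y in b) <[y]> \subset A.
    by rewrite -genb subset_gen.
  by rewrite cycle_subG; apply.
rewrite -genb gen_subG; apply/bigcupsP=> y yb; rewrite cycle_subG.
have ltyb : index y b < 'r(A) by rewrite -sb index_mem.
by have := xM (Ordinal ltyb); rewrite /= nth_index.
Qed.

Lemma homocyclic_isog_gpow (gT : finGroupType) (A : {group gT}) m : 1 < m ->
  homocyclic A -> exponent A = m -> A \isog [set: gpow 'Z_m 'r(A)].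
Proof.
move=> m1 homA expA; have [cAA _] := andP homA.
have [x [xA genA]] := homocyclic_generators homA.
have xm i : x i ^+ m = 1 by rewrite -expA expg_exponent.
pose phi i (k : 'Z_m) := x i ^+ k.
apply: (@gpow_isog gT 'Z_m 'r(A) phi).
- move=> i k l; rewrite /phi -expgD -[RHS](expg_mod _ (xm i)) /=.
  by congr (_ ^+ (_ %% _)); apply: Zp_cast.
- by move=> i j k l _; apply: (centsP cAA); rewrite groupX.
- by move=> i k; rewrite groupX.
- move=> M phiM; apply: genA => i; have := phiM i (inZp 1).
  by rewrite /phi /= modn_small ?Zp_cast.
by rewrite card_homocyclic // expA card_ord Zp_cast.
Qed.

(** * Abelian groups extended by inversion *)


(** If [x] has order neither dividing 4 nor 6, so does every element of the two
    distinct cosets of ['Ldiv_2(A)] through [x] and [x^-1]; this already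
    outweighs the contribution of ['Ldiv_2(A)] itself.  Otherwise [A] is the union
    of the subgroups of exponents 4 and 6, hence one of them. *)
Lemma abelian_sum_weight_exponent (gT : finGroupType) (A : {group gT}) : abelian A ->
    (#|A|%:R / 2 < \sum_(x in A) weight x)%R ->
  exponent A %| 4 \/ exponent A %| 6.
Proof.
move=> cAA ltA; pose A2 := 'Ldiv_2(A).
pose bad (x : gT) := (x ^+ 4 != 1) && (x ^+ 6 != 1).
have A46 : {in A, forall x, (x ^+ 4 == 1) || (x ^+ 6 == 1)}.
  move=> x xA; apply: contraLR ltA; rewrite negb_or => badx; rewrite -leNgt.
  pose B := [set y in A | bad y].
  have sub (y : gT) : y \in A -> bad y -> y *: A2 \subset B.
    move=> yA bady; apply/subsetP=> _ /lcosetP[t /LdivP[tA t2] ->].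
    have cyt : commute y t by apply: (centsP cAA).
    have [t4 t6] : t ^+ 4 = 1 /\ t ^+ 6 = 1.
      by rewrite (expgM t 2 2) (expgM t 2 3) t2 !expg1n.
    by rewrite inE groupM // /bad !expgMn // t4 t6 !mulg1.
  have xVA : x^-1 \in A by rewrite groupV.
  have badV : bad x^-1 by rewrite /bad !expgVn !invg_eq1.
  have leB : 2 * #|A2| <= #|B|.
    rewrite mul2n -addnn -{1}(card_lcoset A2 x) -(card_lcoset A2 x^-1) -cardsUI.
    rewrite (_ : (x *: A2) :&: (x^-1 *: A2) = set0) ?cards0 ?addn0.
      by apply: subset_leq_card; rewrite subUset !sub.
    apply/setP=> y; rewrite in_set0 in_setI !mem_lcoset invgK; apply/negP.
    case/andP=> /LdivP[xVyA xVy2] /LdivP[xyA xy2].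
    have yA : y \in A by rewrite -(groupMl _ xVA).
    have [cxy cxVy] : commute x y /\ commute x^-1 y by split; apply: (centsP cAA).
    move: xVy2 xy2; rewrite !expgMn // expgVn => /eqP.
    rewrite -eq_mulVg1 => /eqP <-; rewrite -expg2 -expgM => x4.
    by case/andP: badx => /eqP[].
  rewrite (big_setID 'Ldiv_2()) /= [X in (_ + X)%R](big_setID B) /=.
  set A' := A :\: _; have defB : A' :&: B = B.
    apply/setIidPr/subsetP=> y; rewrite !inE => /and3P[yA y4 _]; rewrite yA andbT.
    by apply: contra y4 => /eqP y2; rewrite (expgM y 2 2) y2 expg1n.
  have -> : #|A| = (#|A2| + (#|B| + #|A' :\: B|))%N by rewrite -{1}defB cardsID cardsID.
  rewrite defB (eq_bigr (fun=> 1%R)) => [|y /LdivP[_ /weight1] //].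
  have le4 : (\sum_(y in B) weight y <= \sum_(y in B) 4^-1)%R.
    by apply: ler_sum => y; rewrite inE => /and3P[_ y4 y6]; apply: weight_le4.
  have le2 : (\sum_(y in A' :\: B) weight y <= \sum_(y in A' :\: B) 2^-1)%R.
    by apply: ler_sum => y /setDP[/setD_Ldiv2[_ y2] _]; apply: weight_le2.
  move: leB le4 le2; rewrite -(ler_nat rat) natrM !natrD !sumr_const.
  rewrite -(mulr_natl (4^-1)%R) -(mulr_natl (2^-1)%R); lra.
have [s4 | /subsetPn[x xA nx4]] := boolP (A \subset 'Ldiv_4()); first by left; rewrite -sub_LdivT.
right; rewrite -sub_LdivT; apply/subsetP=> y yA; apply: contraR nx4 => ny6.
rewrite !inE in ny6 *; have := A46 x xA; case/orP=> // x6.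
have /orP[y4 | y6] := A46 y yA; last by rewrite y6 in ny6.
have cxy : commute x y by apply: (centsP cAA).
have := A46 (x * y) (groupM xA yA); rewrite !expgMn // (eqP y4) (eqP x6) mulg1 mul1g.
by rewrite (negPf ny6) orbF.
Qed.

Section CaseI.

Variables (gT : finGroupType) (G A : {group gT}) (e : gT).
Hypothesis nC2 : ~ has_C2_factor G.
Hypotheses (defG : A ><| <[e]> = G) (oe : #[e] = 2).
Hypothesis inv : {in A, forall a, a ^ e = a^-1}.
Implicit Types (C K : {group gT}) (x w : gT).

Let cAA : abelian A := inverted_abelian inv.
Let oG : #|G| = (2 * #|A|)%N := sdprod2_card defG oe.

Let nC2A C K : #|C| = 2 -> C \x K <> A.
Proof. by move=> oC defA; apply: nC2 (inverted_C2_factor defG oe inv oC defA). Qed.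

Lemma inverted_nontrivial : A :!=: 1.
Proof.
apply/eqP=> A1; apply: nC2; apply: (@dprod_C2_factor _ G <[e]>%G 1%G).
  by rewrite -orderE.
by rewrite dprodg1 -defG A1 sdprod1g.
Qed.

(** The involutions of [A] are central in [G], since inversion fixes them.  So in
    the absence of a direct factor of order 2 they are squares, which makes [A]
    a direct product of cycles of order 4. *)
Lemma inverted_exponent4 : exponent A %| 4 ->
  exists n, 0 < n /\ A \isog [set: gpow 'Z_4 n] /\ alpha G = alpha_val (2 ^ n)%N.
Proof.
move=> exp4; have A4 x : x \in A -> x ^+ 4 = 1 by move: x; apply/exponentP.
have pA : 2.-group A by rewrite -pnat_exponent (pnat_dvd exp4).
have pG : 2.-group G by rewrite /pgroup oG pnatM; apply/andP.
have defM := MhoEabelian 1 pA cAA.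
have defOhm : 'Ohm_1(A) = 'Ldiv_2(A).
  exact: OhmEabelian pA (abelianS (Ohm_sub 1 A) cAA).
have nMG : 'Mho^1(A) <| G.
  by apply: char_normal_trans (Mho_char 1 A) _; have [] := sdprod_context defG.
have sqrM x : x \in G -> x ^+ 2 \in 'Mho^1(A).
  move=> xG; have [xA | xA] := boolP (x \in A); first by rewrite defM; apply/imsetP; exists x.
  by rewrite (inverted_outside defG oe inv) ?group1.
have eqOM : 'Ohm_1(A) = 'Mho^1(A).
  apply/eqP; rewrite eqEsubset; apply/andP; split; last first.
    rewrite defM defOhm; apply/subsetP=> _ /imsetP[x xA ->]; apply/LdivP.
    by rewrite groupX // -expgM A4.
  rewrite defOhm; apply/subsetP=> w /LdivP[wA w2].
  apply: (central_involution_sqr pG nC2 nMG sqrM _ w2).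
  rewrite inE (subsetP (sdprod2_sub defG)) //=; have [_ <- _ _] := sdprodP defG.
  rewrite centM inE (subsetP cAA) // cent_cycle; apply/cent1P/commgP/conjg_fixP.
  by rewrite inv // invg2.
have exp4E : exponent A = 4.
  have /(dvdn_pfactor _ 2 (isT : prime 2))[[|[|[|k]]] // _ expA] := exp4.
    by case/negP: inverted_nontrivial; rewrite trivg_exponent expA.
  have A2 x : x \in A -> x ^+ 2 = 1 by move: x; apply/exponentP; rewrite expA.
  case/negP: inverted_nontrivial; rewrite -subG1; apply/subsetP=> x xA.
  have : x \in 'Ohm_1(A) by rewrite defOhm; apply/LdivP; rewrite A2.
  by rewrite eqOM defM => /imsetP[y yA ->]; rewrite A2 ?group1.
have homA : homocyclic A by apply/(Ohm1_homocyclicP pA cAA); rewrite exp4E.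
exists 'r(A); split; first by rewrite rank_gt0 inverted_nontrivial.
split; first exact: homocyclic_isog_gpow.
have oA : #|A| = (2 ^ 'r(A) * 2 ^ 'r(A))%N by rewrite card_homocyclic // exp4E -expnMn.
have oL : #|'Ldiv_2(A)| = (2 ^ 'r(A))%N.
  have := mul_card_Ohm_Mho_abelian 1 cAA; rewrite -eqOM defOhm oA !mulnn.
  by move/eqP; rewrite eqn_sqr => /eqP.
apply: alpha_eq_val => [x xG||].
- have [xA | xA] := boolP (x \in A); first by rewrite A4 ?eqxx.
  by rewrite (expgM x 2 2) (inverted_outside defG oe inv xG xA) expg1n eqxx.
- by rewrite expn_gt0.
by rewrite (inverted_Ldiv2 defG oe inv) oL oG oA; move: (2 ^ _)%N => q; ring.
Qed.

(** The Sylow 2-subgroup of [A] is elementary abelian, so if it were nontrivial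
    a direct factor of order 2 would split off. *)
Lemma inverted_exponent6 : exponent A %| 6 ->
  exists n, 0 < n /\ A \isog [set: gpow 'Z_3 n] /\ alpha G = alpha_val (3 ^ n)%N.
Proof.
move=> exp6; have A6 x : x \in A -> x ^+ 6 = 1 by move: x; apply/exponentP.
have defA := nilpotent_pcoreC 2 (abelian_nil cAA).
have O2A : 'O_2(A) = 1.
  apply/eqP; apply: contraT => /trivgPn[w wO w1].
  have O6 : exponent 'O_2(A) %| 6 by apply: dvdn_trans exp6; apply/exponentS/pcore_sub.
  have abO : 2.-abelem 'O_2(A).
    apply: exponent2_abelem.
    have /p_natP[[|[|k]] expO] : 2.-nat (exponent 'O_2(A)).
      by rewrite pnat_exponent pcore_pgroup.
    - by rewrite expO.
    - by rewrite expO.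
    have : 4 %| 6 by apply: dvdn_trans O6; rewrite expO !expnS mulnA dvdn_mulr.
    by [].
  have [|B defO] := abelem_split_dprod abO (_ : <[w]> \subset 'O_2(A)).
    by rewrite cycle_subG.
  have [_ O2] := abelemP (isT : prime 2) abO.
  have ow : #[w] = 2 by apply: nt_prime_order => //; apply: O2.
  move: defA; rewrite -defO -dprodA => defA.
  have [[_ K _ defK] _ _ _] := dprodP defA; rewrite defK in defA.
  by case: (@nC2A <[w]>%G K).
rewrite O2A dprod1g in defA.
have oddA x : x \in A -> coprime #[x] 2.
  move=> xA; have : 2^'.-elt x by apply: mem_p_elt xA; rewrite -defA pcore_pgroup.
  by rewrite coprime_sym /p_elt p'natE // prime_coprime.
have A3 x : x \in A -> x ^+ 3 = 1.
  move=> xA; apply/eqP; rewrite -order_dvdn -(Gauss_dvdr _ (oddA x xA)).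
  by rewrite order_dvdn A6.
have abA : 3.-abelem A by apply/(abelemP (isT : prime 3)).
have expA : exponent A = 3.
  have /(dvdn_pfactor _ 1 (isT : prime 3))[[|[|k]] // _ expA] : exponent A %| 3.
    by apply/exponentP.
  by case/negP: inverted_nontrivial; rewrite trivg_exponent expA.
have homA := abelem_homocyclic abA.
exists 'r(A); split; first by rewrite rank_gt0 inverted_nontrivial.
split; first exact: homocyclic_isog_gpow.
have oA : #|A| = (3 ^ 'r(A))%N by rewrite card_homocyclic // expA.
have L1 : 'Ldiv_2(A) = 1.
  apply/eqP; rewrite eqEsubset; apply/andP; split; apply/subsetP=> x.
    case/LdivP=> xA x2; apply/set1P; have := A3 x xA.
    by rewrite expgS x2 mulg1.
  by move/set1P->; apply/LdivP; rewrite group1 expg1n.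
apply: alpha_eq_val => [x xG||].
- have [xA | xA] := boolP (x \in A); first by rewrite A6 ?eqxx ?orbT.
  by rewrite (expgM x 2 3) (inverted_outside defG oe inv xG xA) expg1n eqxx orbT.
- by rewrite expn_gt0.
by rewrite (inverted_Ldiv2 defG oe inv) L1 cards1 oG oA; move: (3 ^ _)%N => q; ring.
Qed.

End CaseI.

Lemma inverted_index2_caseI (gT : finGroupType) (G : {group gT}) :
    (3%:R / 4%:R < alpha G)%R -> ~ has_C2_factor G ->
  inverted_index2 G -> caseI G.
Proof.
move=> alphaG nC2 [A [e [defG oe inv]]]; exists A, e; split=> //.
have cAA := inverted_abelian inv; have oG := sdprod2_card defG oe.
have A0 : (0 < #|A|%:R :> rat)%R by rewrite ltr0n.
have gtA : (#|A|%:R / 2 < \sum_(x in A) weight x)%R.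
  move: alphaG; rewrite alpha_weight (inverted_sum_weight defG oe inv) oG natrM.
  rewrite ltr_pdivlMr ?mulr_gt0 //; lra.
have [exp4 | exp6] := abelian_sum_weight_exponent cAA gtA.
  have [n [n0 isoA]] := inverted_exponent4 nC2 defG oe inv exp4.
  by exists n; split; last right.
have [n [n0 isoA]] := inverted_exponent6 nC2 defG oe inv exp6.
by exists n; split; last left.
Qed.

(** * Vector spaces extended by an involution *)


Lemma rV_isom (gT : finGroupType) (V : {group gT}) m (B : 'I_m -> gT) :
    2.-abelem V -> (forall j, B j \in V) ->
    (forall M : {group gT}, (forall j, B j \in M) -> V \subset M) ->
    #|V| = (2 ^ m)%N ->
  exists f : {morphism [set: 'rV['F_2]_m] >-> gT},
    isom [set: 'rV['F_2]_m] V f /\ forall j, f (delta_mx ord0 j) = B j.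
Proof.
move=> abV BV genV oV; have [cVV V2] := abelemP (isT : prime 2) abV.
pose F (w : 'rV['F_2]_m) := \prod_(j < m) B j ^+ (w ord0 j).
have FM : {in [set: 'rV['F_2]_m] &, {morph F : w w' / w * w'}}.
  move=> w w' _ _; rewrite /F -prodgM_commute ?index_enum_uniq //.
    apply: eq_bigr => j _; rewrite mxE -expgD -[RHS](expg_mod _ (V2 _ (BV j))).
    by [].
  by move=> i j _; apply: (centsP cVV); rewrite groupX.
have Fdelta j : F (delta_mx ord0 j) = B j.
  rewrite /F (eq_bigr (fun i => if i == j then B j else 1)) => [|i _].
    by rewrite -big_mkcond big_pred1_eq.
  by rewrite mxE eqxx /=; case: eqP => [->|].
exists (Morphism FM); split=> //; apply/isomP.
have imF : Morphism FM @* [set: 'rV['F_2]_m] = V.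
  apply/eqP; rewrite eqEsubset; apply/andP; split.
    apply/subsetP=> _ /morphimP[a _ _ ->]; apply: group_prod => j _.
    by rewrite groupX.
  by apply: genV => j; apply/morphimP; exists (delta_mx ord0 j); rewrite ?inE.
split=> //; rewrite -card_im_injm imF oV cardsT card_mx card_Fp //.
by rewrite mul1n.
Qed.

Lemma delta_basis r (p q : 'I_r -> 'I_(2 * r)) :
    (forall j, (exists i, j = p i) \/ (exists i, j = q i)) ->
  basis_of fullv (codom (fun i => delta_mx ord0 (p i) : 'rV['F_2]_(2 * r))
                    ++ codom (fun i => delta_mx ord0 (q i))).
Proof.
move=> pq; rewrite basisEdim size_cat !size_codom card_ord dimvf /dim /=.
apply/andP; split; last by rewrite mul1n mul2n addnn.
apply/subvP=> w _.
rewrite (row_sum_delta w); apply: rpred_sum => j _; apply: rpredZ; apply: memv_span.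
rewrite mem_cat; have [[i ->] | [i ->]] := pq j.
  by rewrite (codom_f (fun i => delta_mx ord0 (p i))).
by rewrite (codom_f (fun i => delta_mx ord0 (q i))) orbT.
Qed.

Section CaseIV.

Variables (gT : finGroupType) (G V : {group gT}) (c : gT).
Hypothesis nC2 : ~ has_C2_factor G.
Hypotheses (defG : V ><| <[c]> = G) (oc : #[c] = 2) (abV : 2.-abelem V).
Implicit Types (v x : gT).

Let cVV : abelian V := abelem_abelian abV.
Let V2 v : v \in V -> v ^+ 2 = 1.
Proof. by have [_ V2] := abelemP (isT : prime 2) abV; apply: V2. Qed.
Let c2 : c ^+ 2 = 1. Proof. by rewrite -oc expg_order. Qed.
Let nVc v : v \in V -> v ^ c \in V.
Proof.
have [_ _ _ nVc _] := sdprod_context defG.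
by move=> vV; rewrite memJ_norm // (subsetP nVc) ?cycle_id.
Qed.
Let sVG : V \subset G := sdprod2_sub defG.
Let oG : #|G| = (2 * #|V|)%N := sdprod2_card defG oc.

Let comm_c v : v \in V -> [~ v, c] = v * v ^ c.
Proof. by move=> vV; rewrite commgEl invg2 ?V2. Qed.

Let comm_cM : {in V &, {morph (fun v => [~ v, c]) : x y / x * y}}.
Proof.
move=> x y xV yV /=; rewrite !comm_c ?groupM // conjMg.
rewrite -(mulgA x y) (mulgA y) (centsP cVV y yV (x ^ c) (nVc xV)).
by rewrite -(mulgA (x ^ c)) (mulgA x).
Qed.

Let D := Morphism comm_cM.
Let K := 'C_V[c].

Let coset_c x : x \in G -> x \notin V -> x * c \in V := sdprod2_coset defG oc (x := x).

Let sqr_coset v : v \in V -> (v * c) ^+ 2 = [~ v, c].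
Proof. by move=> vV; rewrite comm_c // /conjg (invg2 c2) expg2 !mulgA. Qed.

Let DK v : v \in V -> [~ v, c] \in K.
Proof.
move=> vV; rewrite inE comm_c // groupM ?nVc //=; apply/cent1P/commgP/conjg_fixP.
by rewrite conjMg -conjgM -expg2 c2 conjg1; apply: (centsP cVV); rewrite ?nVc.
Qed.

Let sKZ : K \subset 'Z(G).
Proof.
apply/subsetP=> k /setIP[kV /cent1P ckc]; rewrite inE (subsetP sVG) //=.
have [_ <- _ _] := sdprodP defG.
by rewrite centM inE (subsetP cVV) // cent_cycle; apply/cent1P.
Qed.

(** The squares of [G] are the commutators [[~ v, c]], and the elements of [K] are
    central involutions. *)
Let eqKD : D @* V = K.
Proof.
have sDK : D @* V \subset K by apply/subsetP=> _ /morphimP[v vV _ ->]; apply: DK.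
apply/eqP; rewrite eqEsubset sDK /=; apply/subsetP=> k kK.
have [kV _] := setIP kK.
apply: (central_involution_sqr _ nC2 (sub_center_normal (subset_trans sDK sKZ))).
- by rewrite /pgroup oG pnatM; apply/andP; split=> //; apply: abelem_pgroup abV.
- move=> x xG; have [xV | xV] := boolP (x \in V); first by rewrite V2.
  have xcV := coset_c xG xV; have -> : x = x * c * c by rewrite -mulgA -expg2 c2 mulg1.
  by rewrite sqr_coset //; apply: (mem_morphim D).
- exact: (subsetP sKZ).
exact: V2.
Qed.

(** The square of [v * c] is [[~ v, c]]. *)
Lemma abelem_index2_Ldiv2 : #|'Ldiv_2(G)| = (#|V| + #|K|)%N.
Proof.
rewrite -(cardsID V); congr (_ + _)%N.
  congr #|pred_of_set _|; apply/setP=> x; rewrite !inE andbC; case xV: (x \in V) => //=.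
  by rewrite (subsetP sVG) // V2 // eqxx.
rewrite -(card_rcoset K c); congr #|pred_of_set _|; apply/setP=> x.
rewrite mem_rcoset (invg2 c2); apply/setDP/idP=> [[/LdivP[xG x2] xV] | /setIP[xcV cxc]].
  have xcV := coset_c xG xV; rewrite inE xcV; apply/cent1P/commgP/eqP.
  by rewrite -sqr_coset // -mulgA -expg2 c2 mulg1.
have xE : x = x * c * c by rewrite -mulgA -expg2 c2 mulg1.
have [_ defG' _ tiVc] := sdprodP defG.
have cG : c \in G by rewrite -defG' (subsetP (mulG_subr _ _)) ?cycle_id.
split.
  apply/LdivP; rewrite xE; split; first by rewrite groupM // (subsetP sVG).
  by rewrite sqr_coset //; apply/eqP/commgP/cent1P.
apply: contraL xcV => xV; rewrite groupMl //; apply/negP=> cV.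
have : c \in V :&: <[c]> by rewrite inE cV cycle_id.
by rewrite tiVc => /set1P c1; have := oc; rewrite c1 order1.
Qed.

(** Let [W] be a complement of [K = 'C_V[c]] in [V].  The map [v |-> [~ v, c]] has
    kernel [K] and, by [eqKD], image [K]; so it carries a basis of [W] to one of
    [K]. *)
Lemma abelem_index2_caseIV : caseIV G.
Proof.
have sKV : K \subset V by apply: subsetIl.
have [W defV] := abelem_split_dprod abV sKV.
have [_ defV' _ tiKW] := dprodP defV; have oV := dprod_card defV.
have kerD : 'ker D = K.
  apply/setP=> v; apply/idP/idP=> [kerv | /setIP[vV /cent1P cvc]].
    have vV := dom_ker kerv; rewrite inE vV; apply/cent1P/commgP/eqP.
    exact: mker kerv.
  by apply/(kerP D vV)/eqP/commgP.
have oWK : #|W| = #|K|.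
  rewrite -eqKD card_morphim setIid kerD -divgS // -oV mulKn //.
have sWV : W \subset V by rewrite -defV' mulG_subr.
have abW := abelemS sWV abV; have homW := abelem_homocyclic abW.
have [x [xW genW]] := homocyclic_generators homW.
have ntW : W :!=: 1.
  apply/eqP=> W1; apply: nC2; apply: (@dprod_C2_factor _ G <[c]>%G 1%G).
    by rewrite -orderE.
  have V1 : V :=: 1 by apply/card1_trivg; rewrite -oV -oWK W1 cards1.
  by rewrite dprodg1 -defG V1 sdprod1g.
have oW : #|W| = (2 ^ 'r(W))%N.
  by rewrite (rank_abelem abW) -(card_pgroup (abelem_pgroup abW)).
have r0 : 0 < 'r(W) by rewrite rank_gt0.
move: 'r(W) oW r0 x xW genW => r oW r0 x xW genW.
have oV2 : #|V| = (2 ^ r * 2 ^ r)%N by rewrite -oV -oWK oW.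
have xV i : x i \in V by rewrite (subsetP sWV).
have ltp (i : 'I_r) : i < 2 * r by have := ltn_ord i; lia.
have ltq (i : 'I_r) : r + i < 2 * r by have := ltn_ord i; lia.
pose p i := Ordinal (ltp i); pose q i := Ordinal (ltq i).
pose X k := if insub k is Some i then x i else 1.
pose B (j : 'I_(2 * r)) := if j < r then X j else [~ X (j - r), c].
have Xx (i : 'I_r) : X i = x i by rewrite /X valK.
have Bp i : B (p i) = x i by rewrite /B /= ltn_ord Xx.
have Bq i : B (q i) = [~ x i, c] by rewrite /B /= ltnNge leq_addr /= addKn Xx.
have pq j : (exists i, j = p i) \/ (exists i, j = q i).
  have [ltj | lej] := ltnP j r.
    by left; exists (Ordinal ltj); apply: val_inj.
  have ltj : j - r < r by have := ltn_ord j; lia.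
  by right; exists (Ordinal ltj); apply: val_inj; rewrite /= subnKC.
have BV j : B j \in V.
  have [[i ->] | [i ->]] := pq j; rewrite ?Bp ?Bq //.
  by rewrite (subsetP sKV) ?DK.
have genV (M : {group gT}) : (forall j, B j \in M) -> V \subset M.
  move=> BM; have sWM : W \subset M by apply: genW => i; rewrite -Bp.
  have sWD : W \subset D @*^-1 M.
    by apply: genW => i; apply/morphpreP; rewrite xV /= -Bq.
  rewrite -defV' mul_subG // -[pred_of_set _]/(pred_of_set K) -eqKD.
  apply/subsetP=> _ /morphimP[v _ vV ->].
  have : v \in K * W by rewrite defV'.
  case/mulsgP=> k w kK wW ->; rewrite morphM ?(subsetP sKV k) ?(subsetP sWV w) //.
  rewrite (mker (_ : k \in 'ker D)) ?kerD // mul1g.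
  by have := subsetP sWD w wW; rewrite !inE => /andP[].
have oVr : #|V| = (2 ^ (2 * r))%N by rewrite oV2 mul2n -addnn expnD.
have [f [isof fB]] := rV_isom abV BV genV oVr.
exists r, V, c, f, (fun i => delta_mx ord0 (p i)), (fun i => delta_mx ord0 (q i)).
split=> //; first split=> //.
- apply: alpha_eq_val => [y yG||].
  + have [yV | yV] := boolP (y \in V); first by rewrite (expgM y 2 2) (V2 yV) expg1n eqxx.
    have ycV := coset_c yG yV.
    have -> : y = y * c * c by rewrite -mulgA -expg2 c2 mulg1.
    by rewrite (expgM _ 2 2) sqr_coset // V2 ?eqxx // (subsetP sKV) ?DK.
  + by rewrite expn_gt0.
  by rewrite abelem_index2_Ldiv2 oG oV2 -oWK oW; move: (2 ^ _)%N => k; ring.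
- by split=> //; apply: delta_basis.
move=> i; rewrite !fB Bp Bq; split; last by rewrite commgEl mulKVg.
by apply/conjg_fixP/commgP/cent1P; have /setIP[] := DK (xV i).
Qed.

End CaseIV.

(** * Products of two dihedral groups *)


(** The product [h * a] has order 4 and is inverted by [h], so the results on
    extensions by inversion apply to the dihedral group generated by [h] and
    [a]. *)
Section DihedralPair.

Variables (gT : finGroupType) (h a : gT).
Hypotheses (h2 : h ^+ 2 = 1) (a2 : a ^+ 2 = 1).
Let t := [~ h, a].
Hypotheses (t1 : t != 1) (cth : commute t h) (cta : commute t a).
Let D := <<[set h; a]>>.
Let s := h * a.
Implicit Types x : gT.

Let s2 : s ^+ 2 = t.
Proof. by rewrite /t /s commgEl /conjg (invg2 h2) (invg2 a2) expg2 !mulgA. Qed.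

Let s_h : s ^ h = s^-1.
Proof. by apply/(mul2_inverts s h2); rewrite /s mulgA -expg2 h2 mul1g. Qed.

Let t2 : t ^+ 2 = 1.
Proof.
have : t ^ h = t by apply/conjg_fixP/commgP.
by rewrite -s2 conjXg s_h expgVn => /eqP; rewrite eq_invg_mul -expg2 => /eqP.
Qed.

Let os : #[s] = 4.
Proof.
have : #[s] %| 2 ^ 2 by rewrite order_dvdn (expgM s 2 2) s2 t2.
case/(dvdn_pfactor _ _ (isT : prime 2)) => [[|[|[|k]]]] // _ os.
  by case/eqP: t1; rewrite -s2; apply/eqP; rewrite -order_dvdn os.
by case/eqP: t1; rewrite -s2; apply/eqP; rewrite -order_dvdn os.
Qed.

Let inv : {in <[s]>, forall x, x ^ h = x^-1}.
Proof. by move=> _ /cycleP[k ->]; rewrite conjXg s_h expgVn. Qed.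

Let hs : h \notin <[s]>.
Proof.
apply/negP=> /cycleP[k hk]; case/eqP: t1; rewrite -s2.
have : s ^ h = s by apply/conjg_fixP/commgP; rewrite hk; apply: commuteX.
by rewrite s_h => /eqP; rewrite eq_invg_mul -expg2 => /eqP.
Qed.

Let oh : #[h] = 2.
Proof. by apply: nt_prime_order => //; apply: contraNneq hs => ->; apply: group1. Qed.

Let defD : <[s]> ><| <[h]> = <<[set h; a]>>.
Proof.
have nsh : <[h]> \subset 'N(<[s]>).
  rewrite cycle_subG inE; apply/subsetP=> _ /imsetP[x xs ->].
  by rewrite inv ?groupV.
rewrite sdprodE ?norm_joinEr //; last by rewrite setIC prime_TIg -?orderE ?oh // cycle_subG.
rewrite -norm_joinEr //; apply/eqP; rewrite eqEsubset join_subG !cycle_subG gen_subG.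
have [hD aD] : h \in <<[set h; a]>> /\ a \in <<[set h; a]>> by rewrite !mem_gen ?set21 ?set22.
rewrite hD groupM //=; apply/subsetP=> x /set2P[]->.
  by rewrite (subsetP (joing_subr _ _)) ?cycle_id.
have -> : a = h * s by rewrite /s mulgA -expg2 h2 mul1g.
rewrite groupM // ?(subsetP (joing_subl _ _) s) ?cycle_id //.
by rewrite (subsetP (joing_subr _ _)) ?cycle_id.
Qed.

Let Ldiv2s x : x \in <[s]> -> x ^+ 2 = 1 -> x = 1 \/ x = t.
Proof.
case/cycleP=> k ->; rewrite -expgM => /eqP; rewrite -order_dvdn os.
rewrite -[4]/(2 * 2)%N dvdn_pmul2r // => /dvdnP[j ->]; rewrite mulnC expgM s2.
rewrite (divn_eq j 2) expgD mulnC expgM t2 expg1n mul1g modn2.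
by case: (odd j); [right | left].
Qed.

Lemma dihedral_pair_card : #|D| = 8.
Proof. by rewrite (sdprod2_card defD oh) -orderE os. Qed.

Lemma dihedral_pair_isog : D \isog 'D_8.
Proof.
have oa : #[a] = 2.
  apply: nt_prime_order => //; apply: contraNneq t1 => a1.
  by rewrite /t a1 commg1.
have ha : h != a by apply: contraNneq t1 => ha; rewrite /t ha commgg.
by have := involutions_gen_dihedral oh oa ha; rewrite -/D dihedral_pair_card.
Qed.

Lemma dihedral_pair_Ldiv2 : #|'Ldiv_2(D)| = 6.
Proof.
rewrite (inverted_Ldiv2 defD oh inv) -orderE os.
have -> : 'Ldiv_2(<[s]>) = [set 1; t].
  apply/setP=> x; apply/LdivP/set2P=> [[xs] | [] ->]; first exact: Ldiv2s.
    by rewrite group1 expg1n.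
  by rewrite -{1}s2 mem_cycle.
by rewrite cards2 eq_sym t1.
Qed.

Lemma dihedral_pair_sqr x : x \in D -> x ^+ 2 = 1 \/ x ^+ 2 = t.
Proof.
move=> xD; have [/cycleP[k ->] | xs] := boolP (x \in <[s]>).
  apply: Ldiv2s; first by rewrite groupX ?mem_cycle.
  have s4 : s ^+ (2 * 2) = 1 by rewrite expgM s2 t2.
  by rewrite -(expgM _ 2 2) -expgM mulnC expgM s4 expg1n.
by left; apply: (inverted_outside defD oh inv).
Qed.

Lemma dihedral_pair_center x : x \in D -> commute x h -> commute x a ->
  x = 1 \/ x = t.
Proof.
move=> xD cxh cxa; have [xs | xs] := boolP (x \in <[s]>).
  apply: Ldiv2s => //; have : x ^ h = x by apply/conjg_fixP/commgP.
  by rewrite inv // => /eqP; rewrite eq_invg_mul -expg2 => /eqP.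
have xhs := sdprod2_coset defD oh xD xs.
have : (x * h) ^ h = x * h.
  by apply/conjg_fixP/commgP/commute_sym/commuteM; first exact: commute_sym.
rewrite inv // => /eqP; rewrite eq_invg_mul -expg2 => /eqP /(Ldiv2s xhs) xht.
have cxha : commute (x * h) a.
  by case: xht => ->; [apply: commute_sym; apply: commute1 | ].
have cha : commute h a.
  rewrite -(mulKg x h); apply/commute_sym/commuteM; last exact: commute_sym.
  exact/commuteV/commute_sym.
by case/eqP: t1; apply/eqP/commgP.
Qed.

End DihedralPair.

(** All squares lie in the group generated by the commutators of the two pairs,
    which therefore is the whole centre; and an element common to the dihedral
    groups generated by the pairs is central in both, hence trivial. *)
Lemma commuting_pairs_caseII (gT : finGroupType) (G : {group gT}) :
    #|G| < 2 * #|'Ldiv_2(G)| -> ~ has_C2_factor G ->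
  commuting_pairs G -> caseII G.
Proof.
move=> wallG nC2 [h1 [a [h2 [b [[h1G aG h2G bG] [h12 a2 h22 b2]]]]]].
move=> [ch1h2 ch1b cah2 cab] [t1Z t2Z t1n1 t2n1 t12] genG.
set t1 := [~ h1, a] in t1Z t1n1 t12; set t2 := [~ h2, b] in t2Z t2n1 t12.
have [t1G cGt1] := setIP t1Z; have [t2G cGt2] := setIP t2Z.
have ct1 x : x \in G -> commute t1 x by apply: (centP cGt1).
have ct2 x : x \in G -> commute t2 x by apply: (centP cGt2).
set D1 := <<[set h1; a]>> in genG; set D2 := <<[set h2; b]>> in genG.
have sD1G : D1 \subset G by rewrite gen_subG; apply/subsetP=> x /set2P[]->.
have sD2G : D2 \subset G by rewrite gen_subG; apply/subsetP=> x /set2P[]->.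
have cD12 : D2 \subset 'C(D1).
  rewrite gen_subG; apply/subsetP=> y yS; rewrite /= cent_gen; apply/centP=> x xS.
  case/set2P: yS => ->; case/set2P: xS => ->; apply/commute_sym => //.
have Z2 z : z \in 'Z(G) -> z ^+ 2 = 1 by apply: Ldiv2_center.
have sqr1 x : x \in D1 -> x ^+ 2 = 1 \/ x ^+ 2 = t1.
  by apply: dihedral_pair_sqr => //; apply: ct1.
have sqr2 x : x \in D2 -> x ^+ 2 = 1 \/ x ^+ 2 = t2.
  by apply: dihedral_pair_sqr => //; apply: ct2.
pose T := <<[set t1; t2]>>%G.
have sTZ : T \subset 'Z(G) by rewrite gen_subG; apply/subsetP=> x /set2P[]->.
have t1T : t1 \in T by rewrite mem_gen ?set21.
have t2T : t2 \in T by rewrite mem_gen ?set22.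
have defZD : 'Z(G) <*> D1 <*> D2 = 'Z(G) * D1 * D2.
  have cZ (K : {group gT}) : K \subset G -> K \subset 'C('Z(G)).
    by move=> sKG; rewrite centsC (subset_trans (subsetIr _ _)) ?centS.
  have cZ1 := cZ _ sD1G; have cZ2 := cZ _ sD2G.
  have cZD : D2 \subset 'C('Z(G) <*> D1) by rewrite centY subsetI cZ2.
  by rewrite (cent_joinEr cZD); congr (_ * _); apply: cent_joinEr.
have sqrT x : x \in G -> x ^+ 2 \in T.
  move/(subsetP genG); rewrite defZD => /mulsgP[_ y /mulsgP[z d zZ dD1 ->] yD2 ->].
  have [zG cGz] := setIP zZ.
  have cdy : commute d y by apply/commute_sym/(centsP cD12).
  have dG := subsetP sD1G d dD1; have yG := subsetP sD2G y yD2.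
  rewrite -mulgA expgMn; last by apply: (centP cGz); rewrite groupM.
  rewrite Z2 // mul1g expgMn // groupM //.
    by case: (sqr1 d dD1) => ->.
  by case: (sqr2 y yD2) => ->.
have G4 x : x \in G -> x ^+ 4 = 1.
  by move=> xG; rewrite (expgM x 2 2) Z2 // (subsetP sTZ) ?sqrT.
have pG : 2.-group G.
  by rewrite -pnat_exponent (@pnat_dvd _ 4) //; apply/exponentP.
have sZT : 'Z(G) \subset T.
  apply/subsetP=> z zZ; apply: (central_involution_sqr pG nC2 _ sqrT zZ) (Z2 z zZ).
  exact: sub_center_normal.
have sTD : T \subset D1 <*> D2.
  rewrite gen_subG; apply/subsetP=> x /set2P[]->.
    rewrite (subsetP (joing_subl _ _)) // groupR ?mem_gen ?set21 ?set22 //.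
  by rewrite (subsetP (joing_subr _ _)) // groupR ?mem_gen ?set21 ?set22.
have defG : D1 <*> D2 = G.
  apply/eqP; rewrite eqEsubset join_subG sD1G sD2G /=.
  apply: subset_trans genG _; rewrite join_subG (joing_subr D1 D2) andbT.
  rewrite join_subG (joing_subl D1 D2) andbT; exact: subset_trans sZT sTD.
have tiD : D1 :&: D2 = 1.
  apply/trivgP/subsetP=> x /setIP[xD1 xD2]; apply/set1P.
  have [xZ1 xZ2] : (commute x h1 /\ commute x a) /\ (commute x h2 /\ commute x b).
    have sh : h1 \in D1 /\ a \in D1 by rewrite !mem_gen ?set21 ?set22.
    have sb : h2 \in D2 /\ b \in D2 by rewrite !mem_gen ?set21 ?set22.
    case: sh sb => ? ? [? ?]; split; split.
    - by apply: (centsP cD12).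
    - by apply: (centsP cD12).
    - by apply/commute_sym/(centsP cD12).
    by apply/commute_sym/(centsP cD12).
  have [// | xt1] : x = 1 \/ x = t1.
    by case: xZ1; apply: (dihedral_pair_center h12 a2 t1n1 (ct1 _ h1G) (ct1 _ aG) xD1).
  have [// | xt2] : x = 1 \/ x = t2.
    by case: xZ2; apply: (dihedral_pair_center h22 b2 t2n1 (ct2 _ h2G) (ct2 _ bG) xD2).
  by case/eqP: t12; rewrite -xt1.
have defGd : D1 \x D2 = G by rewrite dprodE // -defG cent_joinEr.
have iso1 : D1 \isog 'D_8 by apply: dihedral_pair_isog => //; apply: ct1.
have iso2 : D2 \isog 'D_8 by apply: dihedral_pair_isog => //; apply: ct2.
split.
  apply: isog_dprod defGd (setX_dprod _ _) _ _.
    exact: isog_trans iso1 (isog_setX1 _ _).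
  exact: isog_trans iso2 (isog_set1X _ _).
rewrite alpha_half => [|x xG]; last by rewrite G4 ?eqxx.
rewrite -(dprod_card defGd) (card_Ldiv_dprod 2 defGd).
have [cth1 cta] := (ct1 _ h1G, ct1 _ aG); have [cth2 ctb] := (ct2 _ h2G, ct2 _ bG).
by rewrite !dihedral_pair_card ?dihedral_pair_Ldiv2.
Qed.

(** * Central products of dihedral groups *)


Section SqrCentral.

Variables (gT : finGroupType) (z : gT).
Hypotheses (z1 : z != 1) (z2 : z ^+ 2 = 1).
Implicit Types (C H M : {group gT}) (x y h g : gT) (s : seq (gT * gT)).

Definition pairgroup (p : gT * gT) := <<[set p.1; p.2]>>.

Definition sqr_in C := {in C, forall x, x ^+ 2 = 1 \/ x ^+ 2 = z}.

Lemma sqr_comm C x y : z \in 'Z(C) -> sqr_in C -> x \in C -> y \in C ->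
  [~ x, y] = 1 \/ [~ x, y] = z.
Proof.
move=> /setIP[zC cCz] sqrC xC yC.
have zV : z^-1 = z by apply: invg2.
have sq w : w \in C -> w ^+ 2 \in [set 1; z] by move/sqrC => []->; rewrite ?set21 ?set22.
have mulz u v : u \in [set 1; z] -> v \in [set 1; z] -> u * v \in [set 1; z].
  by case/set2P=> ->; case/set2P=> ->; rewrite ?mulg1 ?mul1g -?expg2 ?z2 ?set21 ?set22.
have invz u : u \in [set 1; z] -> u^-1 \in [set 1; z].
  by case/set2P=> ->; rewrite ?invg1 ?zV ?set21 ?set22.
apply/set2P; rewrite commg_sqrs.
by apply: (mulz _ _ (mulz _ _ (invz _ _) _) _); apply: sq => //; rewrite groupM ?groupV.
Qed.

Lemma sqr_commMl C x y w : z \in 'Z(C) -> sqr_in C -> x \in C -> y \in C -> w \in C ->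
  [~ x * y, w] = [~ x, w] * [~ y, w].
Proof.
move=> zZ sqrC xC yC wC; rewrite commMgJ; congr (_ * _); apply/conjg_fixP/commgP.
have [-> | ->] := sqr_comm zZ sqrC xC wC; first exact/commute_sym/commute1.
by have /setIP[_ /centP cz] := zZ; apply: cz.
Qed.

(** Modulo [z], squaring is a quadratic form on [C] whose polar form is the
    commutator, and [H] is a maximal totally singular subspace.  An [h] in [H]
    outside the radical and an involution [g] which does not commute with it
    span a hyperbolic plane; it splits off, and the statement holds for its
    centraliser by induction. *)
Lemma hyperbolic_pairs C H : z \in 'Z(C) -> sqr_in C -> 'Z(C) \subset <[z]> ->
    H \subset C -> abelian H -> z \in H -> {in H, forall x, x ^+ 2 = 1} ->
    {in C, forall x, x \in 'C(H) -> x \in H} ->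
  exists s,
    [/\ #|H| = (2 ^ (size s).+1)%N,
        {in s, forall p, [/\ p.1 \in C, p.2 \in C, p.1 ^+ 2 = 1, p.2 ^+ 2 = 1
                            & [~ p.1, p.2] = z]},
        pairwise (fun p q => pairgroup q \subset 'C(pairgroup p)) s &
        forall M, z \in M -> {in s, forall p, pairgroup p \subset M} -> C \subset M].
Proof.
have oz : #[z] = 2 by apply: nt_prime_order.
have [n] := ubnP #|C|; elim: n C H => // n IHn C H ltCn zZ sqrC sZ sHC cHH zH H2 cCH.
have [zC cCz] := setIP zZ.
have comm x y := sqr_comm zZ sqrC (x := x) (y := y).
have commM x y w := sqr_commMl zZ sqrC (x := x) (y := y) (w := w).
have [sHz | /subsetPn[h hH hz]] := boolP (H \subset <[z]>).
  have defH : H :=: <[z]> by apply/eqP; rewrite eqEsubset sHz cycle_subG.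
  exists [::]; split=> //; first by rewrite defH -orderE oz.
  move=> M zM _; apply/subsetP=> x xC.
  have /(subsetP sHz) : x \in H.
    apply: cCH => //; rewrite defH cent_cycle; apply/cent1P.
    exact/commute_sym/(centP cCz).
  by case/cycleP=> k ->; rewrite groupX.
have hC := subsetP sHC h hH; have h2 := H2 h hH.
have zz : z * z = 1 by rewrite -expg2.
have [g [gC g2 hg]] : exists g, [/\ g \in C, g ^+ 2 = 1 & [~ h, g] = z].
  have [g gC hg] : exists2 g, g \in C & [~ h, g] = z.
    have /subsetPn[g gC hg] : ~~ (C \subset 'C[h]).
      apply: contra hz => cCh; apply: (subsetP sZ); rewrite inE hC.
      by rewrite -sub_cent1.
    exists g => //; have [hg1 | //] := comm h g hC gC.
    by case/negP: hg; apply/cent1P/commute_sym/commgP/eqP.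
  have [g2 | g2] := sqrC g gC; first by exists g.
  (* If [g ^+ 2 = z] then [h * g] is an involution: its square is [z * z]. *)
  exists (h * g); split; [exact: groupM | | ].
    rewrite expg2 mulgA -(mulgA h g h) (commgC g h) -[[~ g, h]]invgK invg_comm hg.
    rewrite (invg2 z2) !mulgA -expg2 h2 mul1g -mulgA (centP cCz g gC) mulgA.
    by rewrite -expg2 g2 zz.
  by rewrite commgMJ commgg conj1g mulg1.
have hgC : [set h; g] \subset C by apply/subsetP=> x /set2P[]->.
pose D := pairgroup (h, g); have sDC : D \subset C by rewrite gen_subG.
have [hD gD] : h \in D /\ g \in D by rewrite !mem_gen ?set21 ?set22.
pose C1 := 'C_C(D)%G; pose H1 := (H :&: C1)%G.
have sC1C : C1 \subset C by apply: subsetIl.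
have memC1 x : x \in C -> [~ x, h] = 1 -> [~ x, g] = 1 -> x \in C1.
  move=> xC xh xg; rewrite -[_ \in C1]/(x \in C :&: 'C(<<[set h; g]>>)).
  by rewrite cent_gen in_setI xC /=; apply/centP=> y /set2P[]->; apply/commgP/eqP.
have C1P x : x \in C1 -> [/\ x \in C, [~ x, h] = 1 & [~ x, g] = 1].
  rewrite -[_ \in C1]/(x \in C :&: 'C(<<[set h; g]>>)) cent_gen.
  case/setIP=> xC /centP cx.
  by split=> //; apply/eqP/commgP/cx; rewrite ?set21 ?set22.
have gh : [~ g, h] = z by rewrite -[LHS]invgK invg_comm hg invg2.
have decC x : x \in C -> exists2 d, d \in D & x * d \in C1.
  move=> xC; pose i := [~ x, g] != 1; pose j := [~ x, h] != 1.
  exists (h ^+ i * g ^+ j); first by rewrite groupM ?groupX.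
  have [hiC gjC] : h ^+ i \in C /\ g ^+ j \in C by rewrite !groupX.
  have hh : [~ h ^+ i, h] = 1 by case: (i); rewrite ?commgg ?comm1g.
  have gg : [~ g ^+ j, g] = 1 by case: (j); rewrite ?commgg ?comm1g.
  have xhC : x * h ^+ i \in C by rewrite groupM.
  rewrite mulgA; apply: memC1; first by rewrite groupM.
    rewrite !commM // hh mulg1 /j; have [-> | ->] := comm x h xC hC.
      by rewrite eqxx comm1g mulg1.
    by rewrite z1 expg1 gh zz.
  rewrite !commM // gg mulg1 /i; have [-> | ->] := comm x g xC gC.
    by rewrite eqxx comm1g mulg1.
  by rewrite z1 expg1 hg zz.
have zC1 : z \in C1 by apply: memC1 => //; apply/eqP/commgP/(centP cCz).
have hC1 : h \notin C1 by apply/negP=> /C1P[_ _ hg1]; case/eqP: z1; rewrite -hg.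
have ltC1 : #|C1| < n.
  rewrite -ltnS; apply: leq_trans ltCn; rewrite ltnS; apply: proper_card.
  by rewrite properE sC1C; apply/subsetPn; exists h.
have memH1 x : x \in H -> (x \in H1) = ([~ x, g] == 1).
  move=> xH; rewrite inE xH /=; have xC := subsetP sHC x xH.
  apply/idP/eqP=> [/C1P[] // | xg]; apply: memC1 => //.
  exact/eqP/commgP/(centsP cHH).
have zH1 : z \in H1 by rewrite inE zH.
have zZ1 : z \in 'Z(C1).
  by rewrite inE zC1 (subsetP (centS sC1C)).
have sZ1 : 'Z(C1) \subset <[z]>.
  apply: subset_trans sZ; apply/subsetP=> w /setIP[/[dup] wC1 /C1P[wC wh wg] /centP cw].
  rewrite inE wC; apply/centP=> x xC; have [d dD xdC1] := decC x xC.
  rewrite -(mulgK d x); apply: commuteM; first exact: cw.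
  by apply: commuteV; have /setIP[_ /centP] := wC1; apply.
have hH1 : h \notin H1 by rewrite memH1 // hg.
have oH : #|H| = (2 * #|H1|)%N.
  rewrite -(Lagrange (subsetIl H C1)) mulnC; congr (_ * _)%N.
  apply: (@index2_intro _ H H1 h) => //; first exact: subsetIl.
  move=> x xH; rewrite !memH1 ?groupM // commM ?(subsetP sHC x) // hg.
  by have [-> | -> _] := comm x g (subsetP sHC x xH) gC; rewrite ?eqxx ?zz.
have [||||||s [oH1 sP pw gen1]] := IHn C1 H1 ltC1 zZ1 _ sZ1.
- by move=> x xC1; apply: sqrC; apply: (subsetP sC1C).
- exact: subsetIr.
- exact: abelianS (subsetIl _ _) cHH.
- exact: zH1.
- by move=> x /setIP[xH _]; apply: H2.
- move=> x xC1 cH1x; rewrite inE xC1 andbT; have [xC xh xg] := C1P x xC1.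
  apply: cCH => //; apply/centP=> y yH.
  have [yH1 | yH1] := boolP (y \in H1); first exact: (centP cH1x).
  have hyH1 : h * y \in H1.
    have yC := subsetP sHC y yH; rewrite memH1 // in yH1.
    rewrite memH1 ?groupM // commM // hg.
    by case: (comm y g yC gC) yH1 => ->; rewrite ?eqxx ?zz.
  rewrite -(mulKg h y); apply: commuteM; last exact: (centP cH1x).
  exact/commuteV/commgP/eqP.
exists ((h, g) :: s); split.
- by rewrite oH oH1 -expnS.
- move=> p; rewrite inE => /predU1P[-> // | /sP[p1 p2 ? ? ?]].
  by split; rewrite ?(subsetP sC1C).
- rewrite /= pw andbT; apply/allP=> q /sP[q1 q2 _ _ _].
  have sqC1 : pairgroup q \subset C1 by rewrite gen_subG; apply/subsetP=> x /set2P[]->.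
  exact: subset_trans sqC1 (subsetIr _ _).
move=> M zM pM; have sDM : D \subset M by apply: pM; rewrite mem_head.
have sC1M : C1 \subset M by apply: gen1 => // p ps; apply: pM; rewrite inE ps orbT.
apply/subsetP=> x xC; have [d dD xdC1] := decC x xC.
by rewrite -(mulgK d x) groupM ?groupV ?(subsetP sDM d) // (subsetP sC1M).
Qed.
End SqrCentral.

Section CaseIII.

Variables (gT : finGroupType) (G : {group gT}) (z : gT).
Hypothesis wallG : #|G| < 2 * #|'Ldiv_2(G)|.
Hypothesis nC2 : ~ has_C2_factor G.
Hypotheses (zZ : z \in 'Z(G)) (z1 : z != 1) (z2 : z ^+ 2 = 1).
Hypothesis sqrG : sqr_in z G.

Let zG : z \in G. Proof. by case/setIP: zZ. Qed.

Let sqr_central_Z : 'Z(G) \subset <[z]>.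
Proof.
have zz x : x \in G -> x ^+ 2 \in <[z]> by move/sqrG => []->; rewrite ?group1 ?cycle_id.
have pG : 2.-group G.
  rewrite -pnat_exponent (@pnat_dvd _ 4) //; apply/exponentP=> x /sqrG x2.
  by rewrite (expgM x 2 2); case: x2 => ->; rewrite ?expg1n.
have nzG : <[z]> <| G by apply: sub_center_normal; rewrite cycle_subG.
apply/subsetP=> w wZ; apply: (central_involution_sqr pG nC2 nzG zz wZ).
exact: Ldiv2_center wZ.
Qed.

(** The involutions are counted by [card_Ldiv2_cent]: an element of [H] outside
    the centre [<[z]>] has only one other conjugate. *)
Lemma sqr_central_alpha (H : {group gT}) r : H \in 'E*_2(G) -> #|H| = (2 ^ r.+1)%N ->
  alpha G = alpha_val (2 ^ r).
Proof.
move=> maxH oH; apply: alpha_eq_val => [x /sqrG x2||].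
- by rewrite (expgM x 2 2); case: x2 => ->; rewrite ?z2 ?expg1n ?eqxx.
- by rewrite expn_gt0.
have sHG := maxE_sub maxH.
have zH : z \in H.
  apply: (maxE_cent maxH zG z2); have /setIP[_] := zZ; exact/subsetP/centS.
have oz : #|<[z]>| = 2 by rewrite -orderE; apply: nt_prime_order.
have szH : <[z]> \subset H by rewrite cycle_subG.
have cent2 h : h \in H :\: <[z]> -> (2 * #|'C_G[h]| = #|G|)%N.
  case/setDP=> hH hz; have hG := subsetP sHG h hH.
  have /subsetPn[g gG gh] : ~~ (G \subset 'C_G[h]).
    apply: contra hz => /subsetIP[_ cGh]; apply: (subsetP sqr_central_Z).
    by rewrite inE hG -sub_cent1.
  rewrite -(Lagrange (subsetIl G 'C[h])) mulnC; congr (_ * _)%N; apply/esym.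
  have comm x : x \in G -> x \notin 'C_G[h] -> [~ x, h] = z.
    move=> xG; rewrite inE xG /= => xh; have [c1 | //] := sqr_comm z2 zZ sqrG xG hG.
    by case/negP: xh; apply/cent1P/commgP/eqP.
  apply: (index2_intro (subsetIl _ _) gG gh) => x xG xh; rewrite inE groupM //=.
  by apply/cent1P/commgP/eqP; rewrite (sqr_commMl z2 zZ sqrG) // !comm //.
have := card_Ldiv2_cent maxH wallG; rewrite (big_setID <[z]>) /= (setIidPr szH).
rewrite (eq_bigr (fun=> #|G|)) => [|h hz]; last first.
  rewrite (setIidPl _) // sub_cent1; move: hz => /cycleP[k ->]; apply: groupX.
  by case/setIP: zZ.
rewrite sum_nat_const oz => eqJ.
have : (2 * \sum_(h in H :\: <[z]>) #|'C_G[h]| = #|H :\: <[z]>| * #|G|)%N.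
  by rewrite big_distrr /= -sum_nat_const; apply: eq_bigr => h /cent2.
rewrite cardsD (setIidPr szH) oz oH => eqS.
have := congr1 (muln 2) eqJ; rewrite mulnDr eqS oH expnS.
have : 0 < 2 ^ r by rewrite expn_gt0.
move: (2 ^ r)%N #|G| #|'Ldiv_2(G)| => q g j q0.
have -> : (2 * q - 2 = 2 * (q - 1))%N by lia.
case: q q0 => // q _; rewrite subn1 /=; nia.
Qed.

Section Isomorphism.

Variables (r : nat) (phi : 'I_r -> 'D_8 -> gT) (x y : 'I_r -> gT).
Let D i := <<[set x i; y i]>>.

Hypothesis r_gt0 : 0 < r.
Hypothesis xyG : forall i, x i \in G /\ y i \in G.
Hypothesis x2y2 : forall i, x i ^+ 2 = 1 /\ y i ^+ 2 = 1.
Hypothesis comm_xy : forall i, [~ x i, y i] = z.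
Hypothesis cD : forall i j, i != j -> D j \subset 'C(D i).
Hypothesis genG : forall M : {group gT},
  z \in M -> (forall i, D i \subset M) -> G \subset M.
Hypothesis phiM : forall i, {morph phi i : a b / a * b}.
Hypothesis phi_inj : forall i, injective (phi i).
Hypothesis phiD : forall i, phi i @: setT = D i.

Let phi_in i a : phi i a \in D i.
Proof. by rewrite -phiD imset_f. Qed.

Let cphi i j a b : i != j -> commute (phi i a) (phi j b).
Proof.
by move=> ij; apply/commute_sym/(centsP (cD ij)); apply: phi_in.
Qed.

Let phi1 i : phi i 1 = 1.
Proof. by apply: (mulgI (phi i 1)); rewrite -phiM !mulg1. Qed.

(** An element of the dihedral group [D i] which commutes with both generators is
    1 or their commutator [z]; so all the [phi i] agree on the centre. *)
Let phi_center i a : a \in 'Z('D_8) -> phi i a = if a == 1 then 1 else z.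
Proof.
move=> /setIP[_ /centP aC]; case: eqP => [-> // | /eqP a1].
have ca b : b \in D i -> commute (phi i a) b.
  by rewrite -phiD => /imsetP[d _ ->]; rewrite /commute -!phiM aC ?inE.
have [[x2 y2] [xG yG]] := (x2y2 i, xyG i); have [_ /centP cz] := setIP zZ.
have t1 : [~ x i, y i] != 1 by rewrite comm_xy.
have [ctx cty] : commute [~ x i, y i] (x i) /\ commute [~ x i, y i] (y i).
  by rewrite comm_xy; split; apply: cz.
have [xD yD] : x i \in D i /\ y i \in D i by rewrite !mem_gen ?set21 ?set22.
have := dihedral_pair_center x2 y2 t1 ctx cty (phi_in i a) (ca _ xD) (ca _ yD).
rewrite comm_xy => -[phia | //].
by case/eqP: a1; apply: (phi_inj (i := i)); rewrite phi1.
Qed.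

Let phi_prod i (c : 'I_r -> 'D_8) : phi i (\prod_(j < r) c j) = \prod_(j < r) phi i (c j).
Proof. exact: (big_morph (phi i) (phiM i) (phi1 i)). Qed.

(** Conjugating an element [a] of the kernel in the [i]-th coordinate alone
    changes its image by a value of [phi i], which must be 1; so all coordinates
    of [a] are central, and there all the [phi i] agree by [phi_center]. *)
Lemma D8pow_quotient_isog : G \isog [set: D8pow r] / D8ker r.
Proof.
have phiG i a : phi i a \in G.
  apply: (subsetP (_ : D i \subset G)) (phi_in i a); rewrite gen_subG.
  by apply/subsetP=> _ /set2P[]->; case: (xyG i).
have genphi (M : {group gT}) : (forall i a, phi i a \in M) -> G \subset M.
  move=> phiMM; have DM i : D i \subset M.
    by rewrite -phiD; apply/subsetP=> _ /imsetP[a _ ->].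
  apply: genG => //; rewrite -(comm_xy (Ordinal r_gt0)).
  by rewrite groupR // (subsetP (DM (Ordinal r_gt0))) ?mem_gen ?set21 ?set22.
have [F [FE imF]] := gpow_morphism phiM cphi phiG genphi.
have kerF : 'ker F = D8ker r.
  pose i0 := Ordinal r_gt0.
  have centerF (a : D8pow r) : (forall i, a i \in 'Z('D_8)) ->
    F a = phi i0 (\prod_(i < r) a i).
  - by move=> aZ; rewrite FE phi_prod; apply: eq_bigr => i _; rewrite !phi_center.
  apply/setP=> a; apply/idP/idP=> [kera | ].
    have aZ i : a i \in 'Z('D_8).
      rewrite inE inE /=; apply/centP=> d _; apply/commgP/conjg_fixP.
      pose s := gpow_single i d.
      have : F (a^-1 * a ^ s) = 1.
        apply: mker; rewrite groupM ?groupV // memJ_norm //.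
        by rewrite (subsetP (ker_norm F)) ?inE.
      have -> : a^-1 * a ^ s = gpow_single i ((a i)^-1 * a i ^ d).
        have fM (u v : D8pow r) k : (u * v) k = u k * v k by rewrite ffunE.
        have fV (u : D8pow r) k : u^-1 k = (u k)^-1 by rewrite ffunE.
        apply/ffunP=> j; rewrite /conjg !fM !fV !ffunE; case: eqP => [-> // | _].
        by rewrite invg1 mul1g mulg1 mulVg.
      rewrite FE (prod_gpow_single phiM) -(phi1 i) => /phi_inj/eqP.
      by rewrite -eq_mulVg1 => /eqP.
    rewrite inE; apply/andP; split; first exact/forallP.
    by apply/eqP/(phi_inj (i := i0)); rewrite -centerF // phi1 (mker kera).
  rewrite inE => /andP[/forallP aZ /eqP a1]; apply/kerP; first by rewrite inE.
  by rewrite centerF // a1 phi1.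
by rewrite isog_sym -imF -kerF first_isog.
Qed.

End Isomorphism.

Lemma sqr_central_caseIII : caseIII G.
Proof.
have E1 : 1%G \in 'E_2(G) by rewrite inE sub1G abelem1.
have [H maxH _] := pmaxElem_exists E1; have sHG := maxE_sub maxH.
have zH : z \in H.
  by apply: (maxE_cent maxH zG z2); have /setIP[_] := zZ; apply/subsetP/centS.
have [s [oH sP pw genG]] := hyperbolic_pairs z1 z2 zZ sqrG sqr_central_Z sHG
  (maxE_abelian maxH) zH (maxE_sqr maxH) (maxE_self_cent maxH wallG).
have r0 : 0 < size s.
  rewrite lt0n size_eq0; apply/eqP=> s0; apply: nC2.
  have defG : <[z]> = G.
    apply/eqP; rewrite eqEsubset cycle_subG zG genG ?cycle_id // s0 //.
  apply: (@dprod_C2_factor _ G <[z]>%G 1%G); last by rewrite dprodg1.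
  by rewrite -orderE; apply: nt_prime_order.
pose q (i : 'I_(size s)) := nth (1, 1) s i.
have qs i : q i \in s by rewrite mem_nth.
have pq i : [/\ (q i).1 \in G, (q i).2 \in G, (q i).1 ^+ 2 = 1, (q i).2 ^+ 2 = 1
               & [~ (q i).1, (q i).2] = z] by apply: sP.
have cD i j : i != j -> pairgroup (q j) \subset 'C(pairgroup (q i)).
  have lt (k l : 'I_(size s)) : k < l -> pairgroup (q l) \subset 'C(pairgroup (q k)).
    by move=> ltkl; apply: (pairwiseP (1, 1) pw); rewrite ?inE.
  by rewrite neq_ltn => /orP[/lt // | /lt]; rewrite centsC.
have /fin_all_exists[phi phiP] i : exists phi : 'D_8 -> gT,
    [/\ {morph phi : a b / a * b}, injective phi & phi @: setT = pairgroup (q i)].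
  have [p1 p2 h2 a2 hg] := pq i; have [_ /centP cz] := setIP zZ.
  have : pairgroup (q i) \isog 'D_8.
    by apply: dihedral_pair_isog; rewrite ?hg //; apply: cz.
  rewrite isog_sym => /isogP[f injf imf]; exists f; split.
  - by move=> a b; apply: morphM; rewrite inE.
  - by move=> a b; apply: (injmP injf); rewrite inE.
  by move: imf; rewrite morphimEdom.
exists (size s); split=> //; last exact: sqr_central_alpha maxH oH.
apply: (@D8pow_quotient_isog _ phi (fun i => (q i).1) (fun i => (q i).2)) => //.
- by move=> i; have [] := pq i.
- by move=> i; have [] := pq i.
- by move=> i; have [] := pq i.
- move=> M zM DM; apply: genG => // p ps.
  have lt : index p s < size s by rewrite index_mem.
  by have := DM (Ordinal lt); rewrite /q /= nth_index.
- by move=> i; have [] := phiP i.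
- by move=> i; have [] := phiP i.
by move=> i; have [] := phiP i.
Qed.

End CaseIII.

(** * The classification *)


Lemma alpha_trivial (gT : finGroupType) (G : {group gT}) : G :=: 1 -> alpha G = 1%R.
Proof.
move=> G1; rewrite alpha_weight G1 cards1 big_set1 weight1 ?expg1n //.
Qed.

Theorem theorem5 (gT : finGroupType) (X : {group gT}) :
  (3%:R / 4%:R < alpha X)%R ->
  exists E G : {group gT},
    [/\ E \x G = X, 2.-abelem E, alpha X = alpha G, ~ has_C2_factor G &
        (G :=: 1 /\ alpha X = 1%R) \/
        (caseI G \/ caseII G \/ caseIII G \/ caseIV G)].
Proof.
have [E [G [defX abE nC2]]] := split_C2_factors X.
have alphaX := alpha_dprod defX abE; rewrite alphaX => gtG.
exists E, G; split=> //; have wallG := alpha_gt_involutions gtG.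
have abelem_case : 2.-abelem G -> G :=: 1 /\ alpha G = 1%R.
  by move=> /abelem2_trivial/(_ nC2) G1; split; last exact: alpha_trivial.
case: (mostly_involutions wallG) => [abG | invG | pairsG | [ab2G | [z zZ [z2 sqrG]]]].
- by left; apply: abelem_case.
- by right; left; apply: inverted_index2_caseI.
- by right; right; left; apply: commuting_pairs_caseII.
- right; right; right; right; case: ab2G => V [c [defG oc abV]].
  exact: abelem_index2_caseIV nC2 defG oc abV.
have [zE | z1] := eqVneq z 1; last first.
  by right; right; right; left; apply: sqr_central_caseIII z1 z2 sqrG.
left; apply: abelem_case; apply: exponent2_abelem; apply/exponentP=> x /sqrG.
by rewrite zE; case.
Qed.
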